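(* There exist positive integers $k$ and $t$ such that there is no algorithm which, given a monoid morphism $\mu\colon\Delta^*\to\mathbb{Z}^{k\times k}_{\rm uptr}$, where $\Delta=\{x,y,z_1,z_2\}$ is an alphabet of four distinct letters, decides whether the restriction of $\mu$ to the language $K_t=z_1(x^*y)^{t-1}x^*z_2$ is injective.
   Context: $\mathbb{Z}^{k\times k}_{\rm uptr}$ denotes the monoid (under matrix multiplication) of upper-triangular $k\times k$ matrices with integer entries. $K_t$ is the set of words $z_1x^{a_1}yx^{a_2}y\cdots yx^{a_t}z_2$ with $a_1,\ldots,a_t\ge 0$ (with $t-1$ occurrences of $y$). A morphism $\mu$ is given by the integer matrices $\mu(x),\mu(y),\mu(z_1),\mu(z_2)$. *)

(* Defs.v *)
From mathcomp Require Import all_boot all_algebra.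
Set Implicit Arguments. Unset Strict Implicit. Unset Printing Implicit Defensive.
Import GRing.Theory Num.Theory.
Local Open Scope ring_scope.

(* Programs act on argument lists (seq nat); out-of-range projections give 0.
   This (lax-arity) class computes exactly the partial recursive functions. *)
Inductive rf : Type :=
| RZero : rf
| RSucc : rf
| RProj : nat -> rf
| RComp : rf -> seq rf -> rf
| RPrim : rf -> rf -> rf
| RMu   : rf -> rf.

Inductive eval : rf -> seq nat -> nat -> Prop :=
| ev_zero v : eval RZero v 0
| ev_succ v : eval RSucc v (head 0 v).+1
| ev_proj i v : eval (RProj i) v (nth 0 v i)
| ev_comp f gs v ws y :
    evals gs v ws -> eval f ws y -> eval (RComp f gs) v y
| ev_prim0 f g v y :
    eval f v y -> eval (RPrim f g) (0 :: v) y
| ev_primS f g n v r y :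
    eval (RPrim f g) (n :: v) r -> eval g (n :: r :: v) y ->
    eval (RPrim f g) (n.+1 :: v) y
| ev_mu f v y :
    eval f (y :: v) 0 ->
    (forall z, (z < y)%N -> exists m, eval f (z :: v) m.+1) ->
    eval (RMu f) v y
with evals : seq rf -> seq nat -> seq nat -> Prop :=
| evs_nil v : evals [::] v [::]
| evs_cons g gs v w ws :
    eval g v w -> evals gs v ws -> evals (g :: gs) v (w :: ws).

Inductive letter : Type := lx | ly | lz1 | lz2.

Definition upper_tri (k : nat) (A : 'M[int]_k) : Prop :=
  forall i j : 'I_k, (j < i)%N -> A i j = 0.

Definition mword (k : nat) (mu : letter -> 'M[int]_k) (w : seq letter) : 'M[int]_k :=
  foldr (fun a M => mu a *m M) 1%:M w.

Definition Kword (a : seq nat) : seq letter :=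
  lz1 :: (match a with
          | [::] => [::]
          | a1 :: r => nseq a1 lx ++ flatten [seq ly :: nseq ai lx | ai <- r]
          end) ++ [:: lz2].

(* K_t = { Kword a | size a = t } ; injectivity of mu restricted to K_t *)
Definition injective_on_K (k t : nat) (mu : letter -> 'M[int]_k) : Prop :=
  forall a b : seq nat, size a = t -> size b = t ->
    mword mu (Kword a) = mword mu (Kword b) -> Kword a = Kword b.

Definition enc_int (z : int) : nat :=
  match z with Posz n => n.*2 | Negz n => n.*2.+1 end.

Definition enc_morph (k : nat) (mu : letter -> 'M[int]_k) : seq nat :=
  flatten [seq [seq enc_int (mu l i j) | i <- enum 'I_k, j <- enum 'I_k]
          | l <- [:: lx; ly; lz1; lz2]].

(* Main.v *)
Require Import Defs.
From mathcomp Require Import all_boot all_algebra.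
From mathcomp Require Import zify ring.
From Stdlib Require Import FunctionalExtensionality.
Set Implicit Arguments. Unset Strict Implicit. Unset Printing Implicit Defensive.

(**
  The matrices of a word [z1 x^a_1 y ... y x^a_t z2] can compute any exponential polynomial in the
  [a_i], since [x] may have diagonal entry 2 in the block of position [i].  Given an exponential
  Diophantine system with unknowns [x_1, ..., x_m], choose the morphism so that the word of
  [(x_1, ..., x_m, b)] reveals the [x_i] and the products of [b] with the defects of all
  equations.  Distinct words then have the same matrix only if the [x_i] solve the system, in
  which case [b] is arbitrary: the morphism is injective on [K_(m+1)] iff the system has no
  solution.  It remains to have one system with a parameter [n] whose solvability is not
  decided by any recursive function.  This is the theorem of Davis, Putnam and Robinson; powers
  of 2 being available, the Pell equation is not needed.  The undecidable set consists of the
  codes [n] of functions mapping [n] to 1, expressed by a sequence of coded judgements, each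
  derived from two earlier ones.
*)

(** * Exponential Diophantine predicates *)

Inductive tm : Type :=
| TVar of nat
| TCst of nat
| TAdd of tm & tm
| TMul of tm & tm
| TExp of tm.

Fixpoint ev (t : tm) (e : nat -> nat) : nat :=
  match t with
  | TVar i => e i
  | TCst c => c
  | TAdd a b => ev a e + ev b e
  | TMul a b => ev a e * ev b e
  | TExp a => 2 ^ ev a e
  end.

Fixpoint polynomial (t : tm) : bool :=
  match t with
  | TVar _ | TCst _ => true
  | TAdd a b | TMul a b => polynomial a && polynomial b
  | TExp _ => false
  end.

Fixpoint rename (s : nat -> nat) (t : tm) : tm :=
  match t with
  | TVar i => TVar (s i)
  | TCst c => TCst c
  | TAdd a b => TAdd (rename s a) (rename s b)
  | TMul a b => TMul (rename s a) (rename s b)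
  | TExp a => TExp (rename s a)
  end.

Fixpoint tbound (t : tm) : nat :=
  match t with
  | TVar i => i.+1
  | TCst _ => 0
  | TAdd a b | TMul a b => maxn (tbound a) (tbound b)
  | TExp a => tbound a
  end.

Lemma ev_rename s t e : ev (rename s t) e = ev t (fun i => e (s i)).
Proof. by elim: t => //= [a -> b ->|a -> b ->|a ->]. Qed.

Lemma polynomial_rename s t : polynomial (rename s t) = polynomial t.
Proof. by elim: t => //= a -> b ->. Qed.

Lemma eq_ev_bound t e e' :
  (forall i, i < tbound t -> e i = e' i) -> ev t e = ev t e'.
Proof.
elim: t => //= [i|a IHa b IHb|a IHa b IHb|a IHa] H; first exact: H.
- by rewrite IHa ?IHb // => i Hi; apply: H; rewrite leq_max Hi ?orbT.
- by rewrite IHa ?IHb // => i Hi; apply: H; rewrite leq_max Hi ?orbT.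
- by rewrite IHa.
Qed.

Lemma leq_ev t e e' : (forall i, e i <= e' i) -> ev t e <= ev t e'.
Proof.
move=> H; elim: t => //= [a Ha b Hb|a Ha b Hb|a Ha].
- exact: leq_add.
- exact: leq_mul.
- by rewrite leq_exp2l.
Qed.

(** Exponentials do not respect congruences. This is why [dio] carries a flag: the body of a bounded
    quantifier is evaluated modulo primes. *)
Lemma ev_modn m t e e' : polynomial t ->
  (forall i, i < tbound t -> e i = e' i %[mod m]) -> ev t e = ev t e' %[mod m].
Proof.
elim: t => //= [i _|a IHa b IHb /andP[pa pb]|a IHa b IHb /andP[pa pb]] H; first exact: H.
- by rewrite -modnDm IHa ?IHb ?modnDm // => i Hi; apply: H; rewrite leq_max Hi ?orbT.
- by rewrite -modnMm IHa ?IHb ?modnMm // => i Hi; apply: H; rewrite leq_max Hi ?orbT.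
Qed.

(** Interleaving keeps both parameters and witnesses in infinite supply, so that no arity has to be
    tracked. *)
Definition mix (e w : nat -> nat) : nat -> nat :=
  fun i => if odd i then w i./2 else e i./2.

Lemma mix_even e w : (fun i => mix e w i.*2) = e.
Proof. by apply: functional_extensionality => i; rewrite /mix odd_double doubleK. Qed.

Lemma mix_odd e w : (fun i => mix e w i.*2.+1) = w.
Proof.
by apply: functional_extensionality => i; rewrite /mix /= odd_double /= uphalf_double.
Qed.

(* [b] tells whether exponentials are allowed in the defining equation. *)
Definition dio (b : bool) (R : (nat -> nat) -> Prop) : Prop :=
  exists p q, [/\ b || polynomial p, b || polynomial q &
    forall e, R e <-> exists w, ev p (mix e w) = ev q (mix e w)].

Definition dio_fun (b : bool) (f : (nat -> nat) -> nat) : Prop :=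
  dio b (fun e => e 0 = f (fun i => e i.+1)).

Lemma dio_iff b R R' : (forall e, R e <-> R' e) -> dio b R' -> dio b R.
Proof.
by move=> H [p [q [Hp Hq HR]]]; exists p, q; split=> // e; rewrite H HR.
Qed.

Lemma dio_rename b s p q (R : (nat -> nat) -> Prop) :
  b || polynomial p -> b || polynomial q ->
  (forall e, R e <->
     exists w, ev p (fun i => mix e w (s i)) = ev q (fun i => mix e w (s i))) ->
  dio b R.
Proof.
move=> Hp Hq H; exists (rename s p), (rename s q); rewrite !polynomial_rename.
by split=> // e; rewrite H; split=> -[w Hw]; exists w; move: Hw; rewrite !ev_rename.
Qed.

Lemma dio_eqt b p q : b || polynomial p -> b || polynomial q ->
  dio b (fun e => ev p e = ev q e).
Proof.
move=> Hp Hq; apply: (dio_rename (s := double) Hp Hq) => e.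
by split=> [H|[w]]; [exists id|]; rewrite mix_even.
Qed.

Lemma dio_ren b s R : dio b R -> dio b (fun e => R (fun i => e (s i))).
Proof.
case=> p [q [Hp Hq HR]].
apply: (dio_rename (s := fun i => if odd i then i else (s i./2).*2) Hp Hq) => e.
suff E w : (fun i => mix e w (if odd i then i else (s i./2).*2)) =
           mix (fun i => e (s i)) w.
  by rewrite HR; split=> -[w Hw]; exists w; move: Hw; rewrite E.
apply: functional_extensionality => i; rewrite /mix.
by case Hi: (odd i); rewrite ?Hi ?odd_double ?doubleK.
Qed.

(** Over the integers the equation is [(a - b)^2 + (c - d)^2 = 0], rearranged because terms have no
    subtraction. *)
Lemma eq_sum_squares a b c d :
  a * a + b * b + (c * c + d * d) = 2 * (a * b) + 2 * (c * d) <-> a = b /\ c = d.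
Proof.
split=> [H|[-> ->]]; last by rewrite !mul2n -!addnn.
have [H1 E1] := nat_Cauchy a b; have [H2 E2] := nat_Cauchy c d.
by split; apply/eqP; rewrite -?E1 -?E2; apply/eqP; lia.
Qed.

(** This is [(a - b) * (c - d) = 0], again rearranged. *)
Lemma eq_or_product a b c d : a * c + b * d = a * d + b * c <-> a = b \/ c = d.
Proof.
split; last by case=> ->; lia.
move=> H; case: (eqVneq a b) => [|ab]; [by left|right]; nia.
Qed.

(** The two renamings send the witnesses of two equations to disjoint places, so that one
    environment serves both. *)
Definition wit0 i := if odd i then (i./2).*2.*2.+1 else i.
Definition wit1 i := if odd i then (i./2).*2.+1.*2.+1 else i.

Lemma ev_wit0 t e w : ev (rename wit0 t) (mix e w) = ev t (mix e (fun i => w i.*2)).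
Proof.
rewrite ev_rename; congr ev; apply: functional_extensionality => i.
by rewrite /wit0 /mix; case Hi: (odd i); rewrite ?Hi //= odd_double uphalf_double.
Qed.

Lemma ev_wit1 t e w : ev (rename wit1 t) (mix e w) = ev t (mix e (fun i => w i.*2.+1)).
Proof.
rewrite ev_rename; congr ev; apply: functional_extensionality => i.
by rewrite /wit1 /mix; case Hi: (odd i); rewrite ?Hi //= !odd_double !uphalf_double.
Qed.

Lemma dio_and b R R' : dio b R -> dio b R' -> dio b (fun e => R e /\ R' e).
Proof.
case=> p [q [Hp Hq HR]] [p' [q' [Hp' Hq' HR']]].
set P := rename wit0 p; set Q := rename wit0 q.
set P' := rename wit1 p'; set Q' := rename wit1 q'.
exists (TAdd (TAdd (TMul P P) (TMul Q Q)) (TAdd (TMul P' P') (TMul Q' Q'))).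
exists (TAdd (TMul (TCst 2) (TMul P Q)) (TMul (TCst 2) (TMul P' Q'))).
split; [by rewrite /= !polynomial_rename; case: b Hp Hq Hp' Hq' => //= -> -> -> ->..|].
move=> e; rewrite HR HR'; split.
  case=> -[w Hw] [w' Hw']; exists (mix w w').
  by rewrite /= /P /Q /P' /Q' !ev_wit0 !ev_wit1 mix_even mix_odd; apply/eq_sum_squares.
case=> w; rewrite /= /P /Q /P' /Q' !ev_wit0 !ev_wit1 => /eq_sum_squares[H H'].
by split; [exists (fun i => w i.*2)|exists (fun i => w i.*2.+1)].
Qed.

Lemma dio_or b R R' : dio b R -> dio b R' -> dio b (fun e => R e \/ R' e).
Proof.
case=> p [q [Hp Hq HR]] [p' [q' [Hp' Hq' HR']]].
set P := rename wit0 p; set Q := rename wit0 q.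
set P' := rename wit1 p'; set Q' := rename wit1 q'.
exists (TAdd (TMul P P') (TMul Q Q')), (TAdd (TMul P Q') (TMul Q P')).
split; [by rewrite /= !polynomial_rename; case: b Hp Hq Hp' Hq' => //= -> -> -> ->..|].
move=> e; rewrite HR HR'; split.
  case=> -[w Hw]; [exists (mix w (fun=> 0))|exists (mix (fun=> 0) w)];
  rewrite /= /P /Q /P' /Q' !ev_wit0 !ev_wit1 mix_even mix_odd;
  apply/eq_or_product; [by left|by right].
case=> w; rewrite /= /P /Q /P' /Q' !ev_wit0 !ev_wit1 => /eq_or_product[H|H];
by [left; exists (fun i => w i.*2)|right; exists (fun i => w i.*2.+1)].
Qed.

Lemma dio_exenv b (R : (nat -> nat) -> (nat -> nat) -> Prop) :
  dio b (fun e => R (fun i => e i.*2) (fun i => e i.*2.+1)) ->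
  dio b (fun e => exists w, R e w).
Proof.
case=> p [q [Hp Hq HR]].
(* Inner witnesses become the even witnesses and the quantified environment the odd ones; the
   remaining variables are parameters. *)
pose s i := if odd i then (i./2).*2.*2.+1
            else if odd i./2 then (i./2./2).*2.+1.*2.+1 else i./2.
have E e w : (fun i => mix e w (s i)) =
             mix (mix e (fun i => w i.*2.+1)) (fun i => w i.*2).
  apply: functional_extensionality => i; rewrite /s /mix; case Hi: (odd i).
    by rewrite /= odd_double uphalf_double.
  by case Hi2: (odd i./2); rewrite ?Hi2 //= odd_double uphalf_double.
apply: (dio_rename (s := s) Hp Hq) => e; split=> [[w]|[w]].
  have := HR (mix e w); rewrite mix_even mix_odd => -> -[w' Hw'].
  by exists (mix w' w); rewrite E mix_even mix_odd.
rewrite E => Hw; exists (fun i => w i.*2.+1).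
have := HR (mix e (fun i => w i.*2.+1)); rewrite mix_even mix_odd => ->.
by exists (fun i => w i.*2).
Qed.

Lemma dio_ex b (R : nat -> (nat -> nat) -> Prop) :
  dio b (fun e => R (e 0) (fun i => e i.+1)) -> dio b (fun e => exists x, R x e).
Proof.
move=> D; apply: (@dio_iff _ _ (fun e => exists w : nat -> nat, R (w 0) e)).
  by move=> e; split=> [[x H]|[w H]]; [exists (fun=> x)|exists (w 0)].
apply: dio_exenv.
exact: (dio_ren (fun i => if i is j.+1 then j.*2 else 1) D).
Qed.

(** * Diophantine functions *)

Lemma dio_app b (R : nat -> (nat -> nat) -> Prop) f :
  dio_fun b f -> dio b (fun e => R (e 0) (fun i => e i.+1)) ->
  dio b (fun e => R (f e) e).
Proof.
move=> Df DR; apply: (@dio_iff _ _ (fun e => exists x, x = f e /\ R x e)).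
  by move=> e; split=> [H|[x [->]]] //; exists (f e).
by apply: dio_ex; apply: dio_and.
Qed.

Lemma dio_fun_shift b f : dio_fun b f -> dio_fun b (fun e => f (fun i => e i.+1)).
Proof. exact: (dio_ren (fun i => if i is j.+1 then j.+2 else 0)). Qed.

Lemma dio_app2 b (P : nat -> nat -> Prop) f g :
  dio_fun b f -> dio_fun b g -> dio b (fun e => P (e 0) (e 1)) ->
  dio b (fun e => P (f e) (g e)).
Proof.
move=> Df Dg DP; apply: (dio_app (R := fun x e => P x (g e))) => //.
apply: (dio_app (R := fun y e => P (e 0) y)); first exact: dio_fun_shift.
exact: (dio_ren (fun i => if i is 0 then 1 else 0) DP).
Qed.

Lemma eq_dio_fun b f g : f =1 g -> dio_fun b g -> dio_fun b f.
Proof. by move=> E; apply: dio_iff => e; rewrite E. Qed.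

Lemma dio_fun_var b i : dio_fun b (fun e => e i).
Proof. by apply: (@dio_eqt b (TVar 0) (TVar i.+1)); rewrite /= orbT. Qed.

Lemma dio_fun_const b n : dio_fun b (fun=> n).
Proof. by apply: (@dio_eqt b (TVar 0) (TCst n)); rewrite /= orbT. Qed.

Lemma dio_eq b f g : dio_fun b f -> dio_fun b g -> dio b (fun e => f e = g e).
Proof.
move=> Df Dg; apply: (dio_app2 (P := fun x y => x = y)) => //.
exact: dio_fun_var.
Qed.

Lemma dio_fun_op1 b (o : nat -> nat) f :
  dio b (fun e => e 0 = o (e 1)) -> dio_fun b f -> dio_fun b (fun e => o (f e)).
Proof.
move=> Do Df; apply: (dio_app (R := fun x e => e 0 = o x)); first exact: dio_fun_shift.
exact: (dio_ren (fun i => if i is 0 then 1 else 0) Do).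
Qed.

Lemma dio_fun_op2 b (o : nat -> nat -> nat) f g :
  dio b (fun e => e 0 = o (e 1) (e 2)) -> dio_fun b f -> dio_fun b g ->
  dio_fun b (fun e => o (f e) (g e)).
Proof.
move=> Do Df Dg; apply: (dio_app (R := fun x e => e 0 = o x (g (fun i => e i.+1)))).
  exact: dio_fun_shift.
apply: (dio_app (R := fun y e => e 1 = o (e 0) y)).
  exact: (dio_fun_shift (dio_fun_shift Dg)).
by apply: (dio_ren (fun i => match i with 0 => 2 | 1 => 1 | _ => 0 end) Do).
Qed.

Lemma dio_fun_add b f g :
  dio_fun b f -> dio_fun b g -> dio_fun b (fun e => f e + g e).
Proof.
apply: dio_fun_op2.
by apply: (@dio_eqt b (TVar 0) (TAdd (TVar 1) (TVar 2))); rewrite /= orbT.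
Qed.

Lemma dio_fun_mul b f g :
  dio_fun b f -> dio_fun b g -> dio_fun b (fun e => f e * g e).
Proof.
apply: dio_fun_op2.
by apply: (@dio_eqt b (TVar 0) (TMul (TVar 1) (TVar 2))); rewrite /= orbT.
Qed.

Lemma dio_fun_succ b f : dio_fun b f -> dio_fun b (fun e => (f e).+1).
Proof.
move=> Df; apply: (@eq_dio_fun _ _ (fun e => f e + 1)) => [e|]; first by rewrite addn1.
by apply: dio_fun_add => //; apply: dio_fun_const.
Qed.

Lemma dio_fun_exp2 f : dio_fun true f -> dio_fun true (fun e => 2 ^ f e).
Proof.
apply: (dio_fun_op1 (o := expn 2)).
exact: (@dio_eqt true (TVar 0) (TExp (TVar 1))).
Qed.

Lemma dio_fun_ev b t (F : nat -> (nat -> nat) -> nat) : b || polynomial t ->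
  (forall i, dio_fun b (F i)) -> dio_fun b (fun e => ev t (fun i => F i e)).
Proof.
move=> + DF; elim: t => [i|c|t IHt u IHu|t IHt u IHu|t IHt] //= H.
- exact: dio_fun_const.
- by apply: dio_fun_add; [apply: IHt|apply: IHu]; case: (b) H => //= /andP[].
- by apply: dio_fun_mul; [apply: IHt|apply: IHu]; case: (b) H => //= /andP[].
- by case: b H DF IHt => // H DF IHt; apply: dio_fun_exp2; apply: IHt.
Qed.

Lemma dio_lt b f g : dio_fun b f -> dio_fun b g -> dio b (fun e => f e < g e).
Proof.
move=> Df Dg; apply: (@dio_iff _ _ (fun e => exists x, (f e + x).+1 = g e)).
  by move=> e; split=> [H|[x <-]]; [exists (g e - (f e).+1); lia|rewrite ltnS leq_addr].
apply: dio_ex; apply: dio_eq; last exact: dio_fun_shift.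
by apply: dio_fun_succ; apply: dio_fun_add; [apply: dio_fun_shift|apply: dio_fun_var].
Qed.

Lemma dio_fun_pred b f : dio_fun b f -> dio_fun b (fun e => (f e).-1).
Proof.
apply: (dio_fun_op1 (o := predn)).
apply: (@dio_iff _ _ (fun e => (e 0).+1 = e 1 \/ e 1 = 0 /\ e 0 = 0)) => [e|]; first lia.
by apply: dio_or; [|apply: dio_and]; apply: dio_eq;
  do ?[apply: dio_fun_succ|apply: dio_fun_var|apply: dio_fun_const].
Qed.

Ltac dio_step := cbv beta; lazymatch goal with
  | |- dio _ (fun e => _ /\ _) => apply: dio_and
  | |- dio _ (fun e => _ \/ _) => apply: dio_or
  | |- dio _ (fun e => ex _) => apply: dio_ex
  | |- dio _ (fun e => _ = _ :> nat) => apply: dio_eq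
  | |- dio _ (fun e => is_true (leq (S _) _)) => apply: dio_lt
  | |- dio_fun _ (fun _ => ?c) => apply: dio_fun_const
  | |- dio_fun _ (fun e => S _) => apply: dio_fun_succ
  | |- dio_fun _ (fun e => predn _) => apply: dio_fun_pred
  | |- dio_fun _ (fun e => addn _ _) => apply: dio_fun_add
  | |- dio_fun _ (fun e => muln _ _) => apply: dio_fun_mul
  | |- dio_fun _ (fun e => expn 2 _) => apply: dio_fun_exp2
  | |- dio_fun _ (fun e => e _) => apply: dio_fun_var
  end.

Lemma dio_fun_sub b f g :
  dio_fun b f -> dio_fun b g -> dio_fun b (fun e => f e - g e).
Proof.
apply: (dio_fun_op2 (o := subn)).
apply: (@dio_iff _ _ (fun e => e 0 + e 2 = e 1 \/ e 1 < e 2 /\ e 0 = 0)) => [e|]; first lia.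
by repeat dio_step.
Qed.

Lemma dio_fun_div b f g :
  dio_fun b f -> dio_fun b g -> dio_fun b (fun e => f e %/ g e).
Proof.
apply: (dio_fun_op2 (o := divn)).
apply: (@dio_iff _ _ (fun e => e 2 = 0 /\ e 0 = 0 \/
  exists r, r < e 2 /\ e 1 = e 0 * e 2 + r)) => [e|].
  split=> [->|[[-> ->]|[r [Hr ->]]]]; last 2 first.
  - by rewrite divn0.
  - by rewrite divnMDl ?divn_small ?addn0 //; lia.
  case: (posnP (e 2)) => [->|H]; first by left; rewrite divn0.
  by right; exists (e 1 %% e 2); rewrite ltn_mod -divn_eq.
by repeat dio_step.
Qed.

Lemma dio_fun_mod b f g :
  dio_fun b f -> dio_fun b g -> dio_fun b (fun e => f e %% g e).
Proof.
move=> Df Dg; apply: (@eq_dio_fun _ _ (fun e => f e - f e %/ g e * g e)) => [e|].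
  by rewrite [X in X - _](divn_eq (f e) (g e)) addnC addnK.
by apply: dio_fun_sub => //; apply: dio_fun_mul => //; apply: dio_fun_div.
Qed.

(* [2 ^ u] is congruent to [x] modulo [2 ^ u - x], so general powers reduce to powers of 2. *)
Lemma expn_exp2 x z : x ^ z = 2 ^ ((x * z + x + 1) * z) %% (2 ^ (x * z + x + 1) - x).
Proof.
set u := x * z + x + 1.
have Hx : x < 2 ^ x by exact: ltn_expl.
have H1 : x ^ z <= 2 ^ (x * z).
  by rewrite expnM; case: (z) => // n; rewrite leq_exp2r // ltnW.
have Hu : x ^ z + x < 2 ^ u.
  rewrite /u addn1 expnS expnD.
  have H2 : 0 < 2 ^ (x * z) by rewrite expn_gt0.
  have := leq_pmulr (2 ^ (x * z)) (leq_ltn_trans (leq0n x) Hx).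
  by have := leq_pmull (2 ^ x) H2; lia.
rewrite -[LHS](@modn_small _ (2 ^ u - x)); last lia.
have E : 2 ^ u = x %[mod 2 ^ u - x].
  by rewrite -[X in X %% _](@subnK x) ?modnDl //; lia.
by rewrite expnM -[RHS]modnXm E modnXm.
Qed.

Lemma dio_fun_expn f g :
  dio_fun true f -> dio_fun true g -> dio_fun true (fun e => f e ^ g e).
Proof.
apply: (dio_fun_op2 (o := expn)).
apply: (@dio_iff _ _ (fun e => e 0 =
  2 ^ ((e 1 * e 2 + e 1 + 1) * e 2) %% (2 ^ (e 1 * e 2 + e 1 + 1) - e 1))) => [e|].
  by rewrite expn_exp2.
by apply: dio_eq; [|apply: dio_fun_mod; last apply: dio_fun_sub]; repeat dio_step.
Qed.

Ltac dio_arith := cbv beta; lazymatch goal with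
  | |- dio_fun _ (fun e => subn _ _) => apply: dio_fun_sub
  | |- dio_fun _ (fun e => divn _ _) => apply: dio_fun_div
  | |- dio_fun _ (fun e => modn _ _) => apply: dio_fun_mod
  | |- dio_fun _ (fun e => expn 2 _) => apply: dio_fun_exp2
  | |- dio_fun _ (fun e => expn _ _) => apply: dio_fun_expn
  | |- _ => dio_step
  end.

(** * Binomial coefficients and factorials from powers *)

Lemma digit_sum B n k (f : nat -> nat) : (forall i, f i < B) ->
  (\sum_(i < n) f i * B ^ i) %/ B ^ k %% B = if k < n then f k else 0.
Proof.
move=> Hf; have B0 : 0 < B by apply: leq_ltn_trans (Hf 0).
have split0 m (g : nat -> nat) :
    \sum_(i < m.+1) g i * B ^ i = (\sum_(i < m) g i.+1 * B ^ i) * B + g 0.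
  rewrite big_ord_recl muln1 addnC big_distrl; congr (_ + _).
  by apply: eq_bigr => i _; rewrite /= expnS mulnCA mulnC.
elim: k n f Hf => [|k IHk] [|n] f Hf; rewrite ?big_ord0 ?div0n ?mod0n // split0.
  by rewrite divn1 modnMDl modn_small.
by rewrite expnS divnMA divnMDl // (divn_small (Hf 0)) addn0 (IHk n (fun i => f i.+1)).
Qed.

(** By the binomial theorem the coefficients are the digits of [(B + 1)^n] in base [B = 2^(n+1)];
    they fit, being at most [2^n]. *)
Lemma bin_exp2 n k : 'C(n, k) = (2 ^ n.+1 + 1) ^ n %/ 2 ^ (n.+1 * k) %% 2 ^ n.+1.
Proof.
have Hb i : 'C(n, i) < 2 ^ n.+1.
  case: (ltnP n i) => [H|H]; first by rewrite bin_small ?expn_gt0.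
  rewrite expnS.
  have -> : 2 ^ n = \sum_(j < n.+1) 'C(n, j).
    by rewrite -[2]/(1 + 1) expnDn; apply: eq_bigr => j _; rewrite !exp1n !muln1.
  rewrite (bigD1 (Ordinal (H : i < n.+1))) //= mulnDr.
  have : 0 < 'C(n, i) by rewrite bin_gt0.
  lia.
rewrite addnC expnDn (eq_bigr (fun i : 'I_n.+1 => 'C(n, i) * (2 ^ n.+1) ^ i)) => [|i _].
  rewrite expnM digit_sum //; case: ltnP => // H; exact: bin_small.
by rewrite exp1n mul1n.
Qed.

Lemma leq_ffact_expn r n : r ^_ n <= r ^ n.
Proof. by elim: n => // n IHn; rewrite ffactnSr expnSr leq_mul ?leq_subr. Qed.

(** Up to denominators: the product of the [1 - i/r] with [i < n] is at least [1 - n^2/r]. *)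
Lemma expn_ffact_bound r n : r * r ^ n <= r * r ^_ n + n * n * r ^ n.
Proof.
elim: n => [|n IHn]; first by rewrite ffactn0 expn0 leq_addr.
rewrite ffactnSr expnS; have := leq_ffact_expn r n.
move: (r ^ n) (r ^_ n) IHn => a f IHn fa.
have H1 : r * f <= f * (r - n) + n * a by nia.
have H2 : r * (r * a) <= r * (r * f + n * n * a) by rewrite leq_mul2l IHn orbT.
have H3 : r * (r * f) <= r * (f * (r - n) + n * a) by rewrite leq_mul2l H1 orbT.
by rewrite !mulnDr in H2 H3; lia.
Qed.

(** The exact quotient is [n!] times [r^n / r^_n]. This ratio tends to 1, so for large [r] the
    quotient is at least [n!] and less than [n! + 1]. *)
Lemma fact_divn r n : (n`!.+1) * (n * n) < r -> n`! = r ^ n %/ 'C(r, n).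
Proof.
move=> Hr; have f0 := fact_gt0 n.
have nr : n <= r by nia.
have C0 : 0 < 'C(r, n) by rewrite bin_gt0.
have := leq_ffact_expn r n; have := expn_ffact_bound r n.
rewrite -bin_ffact; move: (r ^ n) ('C(r, n)) C0 => a c c0 H1 H2.
have H3 : a < c * n`! + c.
  rewrite ltnNge; apply/negP => H3.
  have H4 : r * (n`!.+1 * (c * n`!)) <= r * (n`! * a).
    by rewrite leq_mul2l; apply/orP; right; nia.
  have H5 : n`!.+1 * (r * a) <= n`!.+1 * (r * (c * n`!) + n * n * a).
    by rewrite leq_mul2l H1 orbT.
  have a0 : 0 < a by apply: leq_trans H2; rewrite muln_gt0 c0.
  have H6 : n`!.+1 * (n * n) * a < r * a by rewrite ltn_mul2r a0.
  by rewrite !mulSn !mulnDr in H4 H5 H6; lia.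
by rewrite -(subnK H2) addnC mulnC divnMDl // divn_small ?addn0 //; lia.
Qed.

(** This [r] is large enough because [n! <= 2^(n^2)] and [n^2 < 2^(2n)]. *)
Lemma fact_exp2 n : let r := 2 ^ (n * n + (n + n) + 1) in n`! = r ^ n %/ 'C(r, n).
Proof.
apply: fact_divn; rewrite !expnD.
have n2 : n < 2 ^ n by exact: ltn_expl.
have H : n`! <= 2 ^ (n * n).
  rewrite -ffactnn; apply: leq_trans (leq_ffact_expn n n) _.
  by rewrite expnM; case: (n) n2 => // m n2; rewrite leq_exp2r // ltnW.
have H0 := fact_gt0 n.
move: (2 ^ (n * n)) (2 ^ n) (n`!) n2 H H0 => a c f n2 H H0.
have : n * n < c * c by exact: ltn_mul.
move: (n * n) (c * c) => x y xy; nia.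
Qed.

Lemma dio_fun_bin f g :
  dio_fun true f -> dio_fun true g -> dio_fun true (fun e => 'C(f e, g e)).
Proof.
apply: (dio_fun_op2 (o := binomial)).
apply: (@dio_iff _ _ (fun e => e 0 =
  (2 ^ (e 1).+1 + 1) ^ e 1 %/ 2 ^ ((e 1).+1 * e 2) %% 2 ^ (e 1).+1)) => [e|].
  by rewrite bin_exp2.
by repeat dio_arith.
Qed.

Lemma dio_fun_fact f : dio_fun true f -> dio_fun true (fun e => (f e)`!).
Proof.
apply: (dio_fun_op1 (o := factorial)).
pose r n := 2 ^ (n * n + (n + n) + 1).
apply: (@dio_iff _ _ (fun e => e 0 = r (e 1) ^ e 1 %/ 'C(r (e 1), e 1))) => [e|].
  by rewrite {1}fact_exp2.
by rewrite /r; apply: dio_eq; [|apply: dio_fun_div; last apply: dio_fun_bin]; repeat dio_arith.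
Qed.

Ltac dio_auto := repeat (cbv beta; lazymatch goal with
  | |- dio_fun _ (fun e => binomial _ _) => apply: dio_fun_bin
  | |- dio_fun _ (fun e => factorial _) => apply: dio_fun_fact
  | |- _ => dio_arith
  end).

(** * Chinese remainders and bounded quantification *)

Fixpoint crt (q r : nat -> nat) (n : nat) : nat :=
  if n is m.+1 then chinese (\prod_(i < m) q i) (q m) (crt q r m) (r m) else 0.

Lemma coprime_prod_ord (q : nat -> nat) n x :
  (forall i, i < n -> coprime (q i) x) -> coprime (\prod_(i < n) q i) x.
Proof.
move=> H; apply: (big_ind (fun y => coprime y x)) => [|y z Hy Hz|i _].
- exact: coprime1n.
- by rewrite coprimeMl Hy.
- exact: H.
Qed.

Lemma crtP q r n : (forall i j, i < j < n -> coprime (q i) (q j)) ->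
  forall i, i < n -> crt q r n = r i %[mod q i].
Proof.
elim: n => // n IHn H i; rewrite ltnS leq_eqVlt /=.
have co : coprime (\prod_(i < n) q i) (q n).
  by apply: coprime_prod_ord => j Hj; apply: H; rewrite Hj ltnSn.
case/predU1P=> [->|Hi]; first by rewrite chinese_modr.
rewrite -IHn // => [|j l /andP[Hj Hl]]; last by apply: H; rewrite Hj ltnW.
have : q i %| \prod_(i < n) q i by rewrite (bigD1 (Ordinal Hi)) //= dvdn_mulr.
move/modn_dvdm=> E; by rewrite -[LHS]E chinese_modl // E.
Qed.

Lemma eqmod_prod (q : nat -> nat) n a b :
  (forall i j, i < j < n -> coprime (q i) (q j)) ->
  (forall i, i < n -> a = b %[mod q i]) -> a = b %[mod \prod_(i < n) q i].
Proof.
elim: n => [|n IHn] co H; first by rewrite big_ord0 !modn1.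
rewrite big_ord_recr /=; apply/eqP; rewrite chinese_remainder; last first.
  by apply: coprime_prod_ord => j Hj; apply: co; rewrite Hj ltnSn.
apply/andP; split; apply/eqP; last exact: H.
apply: IHn => [i j /andP[Hi Hj]|i Hi]; last by apply: H; rewrite ltnW.
by apply: co; rewrite Hi ltnW.
Qed.

(** The modulus [q_k] satisfies [(k + 1) * (q_k + 1) = L!^2], which makes the product of the moduli
    a single binomial coefficient. The square keeps [q_k + 1] divisible by [L!]. *)
Definition modulus (L k : nat) : nat := ((L`! ^ 2) %/ k.+1).-1.

Section Modulus.
Variables (L : nat) (L3 : 2 < L).

Lemma modulusE k : k < L -> k.+1 * (modulus L k).+1 = L`! ^ 2.
Proof.
move=> kL; have d : k.+1 %| L`! ^ 2 by rewrite expnS dvdn_mulr // dvdn_fact.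
rewrite prednK; first by rewrite mulnC divnK.
by rewrite divn_gt0 // dvdn_leq // expn_gt0 fact_gt0.
Qed.

Lemma fact_dvd_modulus k : k < L -> L`! %| (modulus L k).+1.
Proof.
move=> kL; have d : k.+1 %| L`! by rewrite dvdn_fact.
by rewrite -(@dvdn_pmul2l k.+1) // modulusE // -mulnn; apply: dvdn_mul.
Qed.

(** A prime up to [L] divides [L!], hence [q_k + 1], and so cannot divide [q_k]. *)
Lemma prime_dvd_modulus p k : prime p -> k < L -> p %| modulus L k -> L < p.
Proof.
move=> pp kL d; rewrite ltnNge; apply/negP => pL.
have : p %| (modulus L k).+1.
  by apply: dvdn_trans (fact_dvd_modulus kL); rewrite dvdn_fact // prime_gt0.
by rewrite -addn1 dvdn_addr // dvdn1 => /eqP p1; rewrite p1 in pp.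
Qed.

Lemma modulus_gt1 k : k < L -> 1 < modulus L k.
Proof.
move=> kL; have := dvdn_leq (ltn0Sn _) (fact_dvd_modulus kL).
have : L %| L`! by rewrite dvdn_fact // leqnn andbT; lia.
by move/(dvdn_leq (fact_gt0 _)); lia.
Qed.

Lemma modulus_gt k : k < L -> L < modulus L k.
Proof.
move=> kL; have q1 := modulus_gt1 kL.
apply: leq_trans (dvdn_leq _ (pdiv_dvd _)); last lia.
by apply: (@prime_dvd_modulus _ k) => //; rewrite ?pdiv_prime ?pdiv_dvd.
Qed.

(** A common prime factor would divide [(k + 1) * q_k - (l + 1) * q_l = l - k], yet it exceeds
    [L]. *)
Lemma coprime_modulus k l : k < l < L -> coprime (modulus L k) (modulus L l).
Proof.
move=> /andP[kl lL]; have kL := ltn_trans kl lL.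
rewrite /coprime; apply/negPn/negP => g1.
have g0 : 0 < gcdn (modulus L k) (modulus L l).
  by rewrite gcdn_gt0; have := modulus_gt1 kL; lia.
set g := gcdn _ _ in g1 g0; have pp : prime (pdiv g) by apply: pdiv_prime; lia.
have dk : pdiv g %| modulus L k by rewrite (dvdn_trans (pdiv_dvd _)) // dvdn_gcdl.
have dl : pdiv g %| modulus L l by rewrite (dvdn_trans (pdiv_dvd _)) // dvdn_gcdr.
have Lp := prime_dvd_modulus pp kL dk.
have E : l.+1 * modulus L l + (l - k) = k.+1 * modulus L k.
  by move: (modulusE kL) (modulusE lL) => <-; rewrite !mulnS; lia.
have := dvdn_mull k.+1 dk; rewrite -E dvdn_addr ?dvdn_mull // => /dvdn_leq.
lia.
Qed.

Lemma coprime_moduli N : N <= L ->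
  forall k l, k < l < N -> coprime (modulus L k) (modulus L l).
Proof. by move=> NL k l /andP[kl lN]; apply: coprime_modulus; rewrite kl; lia. Qed.

Lemma modulus_residue k : k < L -> (L`! ^ 2).-1 = k %[mod modulus L k].
Proof. by move=> kL; rewrite -(modulusE kL) mulnS /= addnC modnMDl. Qed.

(** With [c = L!^2 - 1] one has [c - k = (k + 1) * q_k], so the quotients [(c - k) / (k + 1)] that
    make up the binomial coefficient are the moduli. *)
Lemma prod_modulus N : N <= L -> \prod_(k < N) modulus L k = 'C((L`! ^ 2).-1, N).
Proof.
elim: N => [|N IHN] NL; first by rewrite big_ord0 bin0.
rewrite big_ord_recr /= IHN 1?ltnW //; apply/eqP.
rewrite -(@eqn_pmul2l N.+1) // mul_bin_left mulnCA mulnC; apply/eqP; congr (_ * _).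
by have := modulusE NL; rewrite mulnS => <-; lia.
Qed.

End Modulus.

(** A prime dividing the product divides a factor [a - j]. Thus divisibility of [C(a, u)] bounds a
    residue of [a]. *)
Lemma dvdn_ffact_mod p u a : prime p -> p %| a ^_ u -> exists2 j, j < u & a = j %[mod p].
Proof.
move=> pp; elim: u => [|u IHu].
  by rewrite ffactn0 dvdn1 => /eqP p1; rewrite p1 in pp.
rewrite ffactnSr Euclid_dvdM // => /orP[/IHu[j ju E]|d]; first by exists j; rewrite // ltnW.
(* For [a <= u] the truncated difference is 0, but [a] itself is a small enough representative. *)
case: (leqP a u) => au; first by exists a.
by exists u => //; apply/eqP; rewrite eqn_mod_dvd // ltnW.
Qed.

Lemma dvdn_ffact_sub u j a : j < u -> a - j %| a ^_ u.
Proof.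
elim: u => // u IHu; rewrite ltnS leq_eqVlt ffactnSr => /predU1P[->|H].
  exact: dvdn_mull.
by rewrite dvdn_mulr // IHu.
Qed.

(** Counterpart of [dvdn_ffact_mod]: since [u!] divides [L!] and hence [q_k + 1], it is coprime to
    [q_k] and can be cancelled from the falling factorial. *)
Lemma modulus_dvd_bin L u k j a : 2 < L -> u <= L -> k < L -> j < u ->
  a = j %[mod modulus L k] -> modulus L k %| 'C(a, u).
Proof.
move=> L3 uL kL ju E; case: (ltnP a u) => [au|ua]; first by rewrite bin_small.
have co : coprime (modulus L k) u`!.
  apply: coprime_dvdr (coprimenS _); apply: dvdn_trans (fact_dvd_modulus kL).
  by rewrite -(bin_fact uL) mulnCA dvdn_mulr.
rewrite -(Gauss_dvdl _ co) bin_ffact; apply: dvdn_trans (dvdn_ffact_sub a ju).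
by rewrite -eqn_mod_dvd ?E //; lia.
Qed.

Definition scons (x : nat) (e : nat -> nat) : nat -> nat :=
  fun i => if i is j.+1 then e j else x.

Lemma finite_choice (P : nat -> (nat -> nat) -> Prop) N :
  (forall k, k < N -> exists w, P k w) ->
  exists W, forall k, k < N -> P k (W k).
Proof.
elim: N => [|N IHN] H; first by exists (fun _ => id).
have [W HW] := IHN (fun k kN => H k (ltnW kN)).
have [w Hw] := H N (ltnSn N).
exists (fun k => if k == N then w else W k) => k.
rewrite ltnS leq_eqVlt; case: eqP => [-> //|_ /=]; exact: HW.
Qed.

Lemma finite_bound (f : nat -> nat -> nat) N m :
  exists u, forall k i, k < N -> i < m -> f k i < u.
Proof.
exists (\sum_(k < N) \sum_(i < m) f k i).+1 => k i kN im.
by rewrite ltnS (bigD1 (Ordinal kN)) // (bigD1 (Ordinal im)) //= -addnA leq_addr.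
Qed.

(** Here [e 0] bounds the quantified variable and [u] the witnesses. By monotonicity the level
    dominates both sides of every instance, so primes above it detect true equality. *)
Definition ball_level (p q : tm) (e : nat -> nat) (u : nat) : nat :=
  ev p (mix e (fun=> u)) + ev q (mix e (fun=> u)) + e 0 + u + 3.

Lemma ball_level_ge p q e u : let L := ball_level p q e u in
  [/\ 2 < L, e 0 <= L, u <= L, ev p (mix e (fun=> u)) <= L & ev q (mix e (fun=> u)) <= L].
Proof. by rewrite /= /ball_level; split; lia. Qed.

(* The value [(L`! ^ 2).-1] is congruent to every [k < e 0] modulo the [k]-th modulus, and the
   product of these moduli is a binomial coefficient; so a single congruence says that
   Chinese remainders of the witnesses solve all instances.  A solution modulo a prime
   factor, being smaller than that prime, is a true solution. *)
Lemma ball_congruence p q e : polynomial p -> polynomial q ->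
  let m := maxn (tbound p) (tbound q) in
  (forall k, k < e 0 ->
     exists w, ev p (mix (scons k (fun i => e i.+1)) w) =
               ev q (mix (scons k (fun i => e i.+1)) w)) <->
  (exists u a,
     let c := ((ball_level p q e u)`! ^ 2).-1 in
     (forall j, j < m -> 'C(a j, u) %% 'C(c, e 0) = 0) /\
     ev p (mix (scons c (fun i => e i.+1)) a) %% 'C(c, e 0) =
     ev q (mix (scons c (fun i => e i.+1)) a) %% 'C(c, e 0)).
Proof.
move=> Pp Pq m; set tl := fun i => e i.+1.
have bnd (t : tm) : tbound t <= m -> forall k x w w' M, polynomial t ->
    x = k %[mod M] -> (forall j, j < m -> w j = w' j %[mod M]) ->
    ev t (mix (scons x tl) w) = ev t (mix (scons k tl) w') %[mod M].
  move=> tm k x w w' M Pt E H; apply: ev_modn => // i Hi; rewrite /mix.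
  by case: ifP => _; [apply: H; lia|case: (i./2)].
have pm : tbound p <= m by rewrite leq_max leqnn.
have qm : tbound q <= m by rewrite leq_max leqnn orbT.
split.
  (* A strict bound [u] on all chosen witnesses comes first; the level depends on it. *)
  move=> /finite_choice[W HW]; have [u Hu] := finite_bound W (e 0) m; exists u.
  have := ball_level_ge p q e u; move: (ball_level p q e u) => L /= [L3 NL uL _ _].
  have co := coprime_moduli L3 NL.
  have Ha j k : k < e 0 -> crt (modulus L) (fun k => W k j) (e 0) = W k j %[mod modulus L k].
    exact: (@crtP _ (fun k => W k j) _ co).
  exists (fun j => crt (modulus L) (fun k => W k j) (e 0)).
  set c := (L`! ^ 2).-1; rewrite -(prod_modulus L3 NL); split=> [j jm|].
    rewrite -[RHS](mod0n (\prod_(k < e 0) modulus L k)).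
    apply: eqmod_prod => // k kN; apply/eqP; rewrite mod0n.
    apply: (@modulus_dvd_bin L u k (W k j)) => //; [lia|exact: Hu|exact: Ha].
  apply: eqmod_prod => // k kN.
  have ck : c = k %[mod modulus L k] by apply: modulus_residue; lia.
  rewrite (bnd p pm k _ _ (W k)) ?(bnd q qm k _ _ (W k)) ?HW // => j _; exact: Ha.
case=> u; have := ball_level_ge p q e u; move: (ball_level p q e u) => L /= [L3 NL uL pL qL].
case=> a; set c := (L`! ^ 2).-1 => -[Hb He] k kN; have kL := leq_trans kN NL.
have q1 := modulus_gt1 L3 kL.
(* A prime factor is taken because only a prime dividing a falling factorial must divide one of its
   factors. *)
set r := pdiv (modulus L k); have pr : prime r by exact: pdiv_prime.
have rk : r %| modulus L k := pdiv_dvd _.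
have Lr : L < r := prime_dvd_modulus pr kL rk.
have rM : r %| 'C(c, e 0).
  by rewrite -(prod_modulus L3 NL) (bigD1 (Ordinal kN)) //= dvdn_mulr.
(* Witnesses from [m] on do not occur in [p] and [q]; the value 0 keeps them below [u]. *)
pose w j := if j < m then a j %% r else 0.
have wu j : w j <= u.
  rewrite /w; case: ifP => // jm.
  have : r %| a j ^_ u.
    by rewrite -bin_ffact dvdn_mulr // (dvdn_trans rM) // /dvdn Hb.
  case/(dvdn_ffact_mod pr) => i iu ->; rewrite modn_small ?(ltnW iu) //.
  exact: leq_trans (leq_trans iu uL) (ltnW Lr).
have ck : c = k %[mod r].
  by have := modulus_residue kL => /(congr1 (modn^~ r)); rewrite !modn_dvdm.
have aw j : j < m -> a j = w j %[mod r] by move=> jm; rewrite /w jm modn_mod.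
have small (t : tm) : ev t (mix e (fun=> u)) <= L -> ev t (mix (scons k tl) w) < r.
  move=> tL; apply: leq_ltn_trans Lr; apply: leq_trans tL; apply: leq_ev => i.
  rewrite /mix; case: ifP => // _; case: (i./2) => //=; exact: ltnW.
exists w; rewrite -[LHS](@modn_small _ r) ?small //.
rewrite -[RHS](@modn_small _ r) ?small //.
rewrite -(bnd p pm k c a w r Pp ck aw) -(bnd q qm k c a w r Pq ck aw).
by move/(congr1 (modn^~ r)): He; rewrite !modn_dvdm.
Qed.

Lemma dio_all b m (P : nat -> (nat -> nat) -> Prop) :
  (forall j, dio b (P j)) -> dio b (fun e => forall j, j < m -> P j e).
Proof.
move=> DP; elim: m => [|m IHm].
  by apply: (@dio_iff _ _ (fun=> 0 = 0)); [split|repeat dio_step].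
apply: (@dio_iff _ _ (fun e => (forall j, j < m -> P j e) /\ P m e)).
  move=> e; split=> [H|[H Hm] j]; first by split=> [j jm|]; apply: H; rewrite // ltnW.
  by rewrite ltnS leq_eqVlt => /predU1P[->|/H].
exact: dio_and.
Qed.

Lemma dio_fun_ev_mix b t (X Y : (nat -> nat) -> nat -> nat) : b || polynomial t ->
  (forall i, dio_fun b (fun e => X e i)) -> (forall i, dio_fun b (fun e => Y e i)) ->
  dio_fun b (fun e => ev t (mix (X e) (Y e))).
Proof.
move=> Ht DX DY; apply: (dio_fun_ev (F := fun i e => mix (X e) (Y e) i)) => // i.
by rewrite /mix; case: (odd i).
Qed.

(** The body must be polynomial for the sake of [ev_modn]; the result is exponential through
    factorials and binomial coefficients. *)
Lemma dio_ball (R : nat -> (nat -> nat) -> Prop) f :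
  dio false (fun e => R (e 0) (fun i => e i.+1)) -> dio_fun true f ->
  dio true (fun e => forall k, k < f e -> R k e).
Proof.
case=> p [q [/= Pp Pq HR]] Df.
apply: (dio_app (R := fun x e => forall k, k < x -> R k e)) => //.
apply: dio_iff => [e|].
  apply: (iff_trans _ (ball_congruence e Pp Pq)).
  by split=> H k kN; [apply/(HR (scons k (fun i => e i.+1)))|
                      apply/(HR (scons k (fun i => e i.+1)))]; apply: H.
apply: dio_ex; apply: dio_exenv.
(* Now variable 0 is [u], variable 2 is the bound, later even variables are the parameters, and odd
   ones are the Chinese remainders [a]. *)
set c := fun e : nat -> nat =>
  ((ball_level p q (fun i : nat => e i.+1.*2) (e 0.*2))`! ^ 2).-1.
have Dc : dio_fun true c.
  by rewrite /c /ball_level; dio_auto; apply: dio_fun_ev_mix => // i; dio_auto.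
have Dev t : dio_fun true (fun e => ev t (mix (scons (c e) (fun i => e i.+2.*2))
                                              (fun i => e i.*2.+1))).
  by apply: dio_fun_ev_mix => // -[|i] //=; dio_auto.
have DM : dio_fun true (fun e => 'C(c e, e 1.*2)) by apply: dio_fun_bin; dio_auto.
apply: dio_and; last by apply: dio_eq; apply: dio_fun_mod.
by apply: dio_all => j; apply: dio_eq; [apply: dio_fun_mod => //|]; dio_auto.
Qed.

(** * Coding evaluations of partial recursive functions *)

Section EvalInd.
Variables (P : rf -> seq nat -> nat -> Prop) (Q : seq rf -> seq nat -> seq nat -> Prop).
Hypotheses
  (Hzero : forall v, P RZero v 0)
  (Hsucc : forall v, P RSucc v (head 0 v).+1)
  (Hproj : forall i v, P (RProj i) v (nth 0 v i))
  (Hcomp : forall f gs v ws y, Q gs v ws -> P f ws y -> P (RComp f gs) v y)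
  (Hprim0 : forall f g v y, P f v y -> P (RPrim f g) (0 :: v) y)
  (HprimS : forall f g n v r y, P (RPrim f g) (n :: v) r -> P g (n :: r :: v) y ->
     P (RPrim f g) (n.+1 :: v) y)
  (Hmu : forall f v y, P f (y :: v) 0 ->
     (forall z, z < y -> exists m, P f (z :: v) m.+1) -> P (RMu f) v y)
  (Hnil : forall v, Q [::] v [::])
  (Hcons : forall g gs v w ws, P g v w -> Q gs v ws -> Q (g :: gs) v (w :: ws)).

(* The scheme generated by Rocq has no induction hypothesis for the evaluations under
   the existential quantifier of [ev_mu]. *)
Fixpoint eval_evals_ind p v y (H : eval p v y) {struct H} : P p v y
with evals_eval_ind gs v ws (H : evals gs v ws) {struct H} : Q gs v ws.
Proof.
- case: H => [w|w|i w|f gs w ws z Hgs Hf|f g w z Hf|f g n w r z Hr Hg|f w z Hf Hz].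
  + exact: Hzero.
  + exact: Hsucc.
  + exact: Hproj.
  + exact: Hcomp (evals_eval_ind _ _ _ Hgs) (eval_evals_ind _ _ _ Hf).
  + exact: Hprim0 (eval_evals_ind _ _ _ Hf).
  + exact: HprimS (eval_evals_ind _ _ _ Hr) (eval_evals_ind _ _ _ Hg).
  + apply: Hmu (eval_evals_ind _ _ _ Hf) _ => x /Hz[m Hm].
    by exists m; exact: eval_evals_ind Hm.
- case: H => [w|g gs' w x xs Hg Hgs]; first exact: Hnil.
  exact: Hcons (eval_evals_ind _ _ _ Hg) (evals_eval_ind _ _ _ Hgs).
Qed.

End EvalInd.

Lemma eval_fun p v y : eval p v y -> forall y', eval p v y' -> y = y'.
Proof.
apply: (eval_evals_ind (P := fun p v y => forall y', eval p v y' -> y = y')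
         (Q := fun gs v ws => forall ws', evals gs v ws' -> ws = ws')) => {p v y}.
- by move=> v y' H; inversion H.
- by move=> v y' H; inversion H.
- by move=> i v y' H; inversion H.
- move=> f gs v ws y IHg IHf y' H; inversion H as [| | |f' gs' v' ws' y'' Hg Hf| | |]; subst.
  by apply: IHf; rewrite (IHg _ Hg).
- by move=> f g v y IHf y' H; inversion H; subst; apply: IHf.
- move=> f g n v r y IHr IHg y' H; inversion H as [| | | | |f' g' n' v' r' y'' Hr Hg|]; subst.
  by apply: IHg; rewrite (IHr _ Hr).
- move=> f v y IH0 IHS y' H; inversion H as [| | | | | |f' v' y'' H0 HS]; subst.
  case: (ltngtP y y') => // [/HS[m /IH0] //|/IHS[m Hm]].
  by have := Hm _ H0.
- by move=> v ws' H; inversion H.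
- move=> g gs v w ws IHg IHgs ws' H; inversion H as [|g' gs' v' w' ws'' Hg Hgs]; subst.
  by rewrite (IHg _ Hg) (IHgs _ Hgs).
Qed.

(** * Numerical codes and a proof system for evaluations *)

Definition pr (x y : nat) : nat := (x + y) * (x + y) + x.
Arguments pr : simpl never.

(** The code lies between the squares of [x + y] and [x + y + 1], so it determines the sum and then
    [x]. *)
Lemma pr_inj a b c d : pr a b = pr c d -> a = c /\ b = d.
Proof.
rewrite /pr; have sq s t : s < t -> s * s + s < t * t by nia.
case: (ltngtP (a + b) (c + d)) => [/sq|/sq|E]; rewrite ?E; lia.
Qed.

Definition pcons (x v : nat) : nat := (pr x v).+1.

Fixpoint code_seq (v : seq nat) : nat :=
  if v is x :: v' then pcons x (code_seq v') else 0.

Fixpoint code (p : rf) : nat :=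
  match p with
  | RZero => pr 0 0
  | RSucc => pr 1 0
  | RProj i => pr 2 i
  | RComp f gs => pr 3 (pr (code f) (code_seq (map code gs)))
  | RPrim f g => pr 4 (pr (code f) (code g))
  | RMu f => pr 5 (code f)
  end.

(* Tag 0: [a] evaluates on [b] to [c]; tag 1: the list [a] evaluates on [b] to the list [c];
   tag 2: [a] is positive on [z :: b] for all [z < c]; tag 3: item [b] of [a] is [c].
   The number [0] codes a trivially true judgement. *)
Definition judge (tag a b c : nat) : nat := (pr tag (pr a (pr b c))).+1.

Lemma judge_inj s a b c t a' b' c' :
  judge s a b c = judge t a' b' c' -> [/\ s = t, a = a', b = b' & c = c'].
Proof. by case=> /pr_inj[-> /pr_inj[-> /pr_inj[-> ->]]]. Qed.

(** One disjunct per inference rule. The many premises of a minimization are accumulated by tag 2,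
    so two premises suffice. Only existential quantifiers and polynomial equations occur, so [step]
    may stand under a bounded quantifier. *)
Definition step (a b c : nat) : Prop :=
  (exists v, c = judge 0 (pr 0 0) v 0) \/
  (c = judge 0 (pr 1 0) 0 1) \/
  (exists x v, c = judge 0 (pr 1 0) (pcons x v) x.+1) \/
  (exists v i y, a = judge 3 v i y /\ c = judge 0 (pr 2 i) v y) \/
  (exists f gs v ws y, a = judge 1 gs v ws /\ b = judge 0 f ws y /\
     c = judge 0 (pr 3 (pr f gs)) v y) \/
  (exists f g v y, a = judge 0 f v y /\ c = judge 0 (pr 4 (pr f g)) (pcons 0 v) y) \/
  (exists f g n v r y, a = judge 0 (pr 4 (pr f g)) (pcons n v) r /\
     b = judge 0 g (pcons n (pcons r v)) y /\
     c = judge 0 (pr 4 (pr f g)) (pcons n.+1 v) y) \/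
  (exists f v y, a = judge 0 f (pcons y v) 0 /\ b = judge 2 f v y /\
     c = judge 0 (pr 5 f) v y) \/
  (exists f v, c = judge 2 f v 0) \/
  (exists f v y m, a = judge 2 f v y /\ b = judge 0 f (pcons y v) m.+1 /\
     c = judge 2 f v y.+1) \/
  (exists v, c = judge 1 0 v 0) \/
  (exists g gs v w ws, a = judge 0 g v w /\ b = judge 1 gs v ws /\
     c = judge 1 (pcons g gs) v (pcons w ws)) \/
  (exists i, c = judge 3 0 i 0) \/
  (exists x v, c = judge 3 (pcons x v) 0 x) \/
  (exists x v i y, a = judge 3 v i y /\ c = judge 3 (pcons x v) i.+1 y).

Inductive derivable : nat -> Prop :=
| derivable0 : derivable 0
| derivableS a b c : derivable a -> derivable b -> step a b c -> derivable c.

(** The rules apply to arbitrary numbers, so truth is claimed only for judgements about codes of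
    functions and lists. *)
Definition judgement_true (c : nat) : Prop :=
  [/\ forall p v y, c = judge 0 (code p) (code_seq v) y -> eval p v y,
      forall gs v ws, c = judge 1 (code_seq (map code gs)) (code_seq v) ws ->
        exists2 ws', ws = code_seq ws' & evals gs v ws',
      forall f v y, c = judge 2 (code f) (code_seq v) y ->
        forall z, z < y -> exists m, eval f (z :: v) m.+1 &
      forall v i y, c = judge 3 (code_seq v) i y -> y = nth 0 v i].

Ltac judge_inv := repeat match goal with
  | _ => progress subst
  | H : judge _ _ _ _ = judge _ _ _ _ |- _ => apply judge_inj in H; destruct H
  | H : pr _ _ = pr _ _ |- _ => apply pr_inj in H; destruct H
  | H : pcons _ _ = pcons _ _ |- _ => apply eq_add_S in H
  | H : S _ = S _ |- _ => apply eq_add_S in H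
  | H : 0 = S _ |- _ => discriminate H
  | H : S _ = 0 |- _ => discriminate H
  | H : 0 = pcons _ _ |- _ => discriminate H
  | H : pcons _ _ = 0 |- _ => discriminate H
  | H : _ = code ?p |- _ => is_var p; destruct p; cbn [code] in H
  | H : _ = code_seq (map code ?v) |- _ => is_var v; destruct v; cbn [map code_seq] in H
  | H : _ = code_seq ?v |- _ => is_var v; destruct v; cbn [code_seq] in H
  end.

Lemma derivable_true c : derivable c -> judgement_true c.
Proof.
elim=> [|a b {}c _ [Ea La Ma Na] _ [Eb Lb Mb Nb]]; first by split.
case=> [[v H]|].
  by split; intros; judge_inv; constructor.
case=> [H|].
  by split; intros; judge_inv; exact: (ev_succ [::]).
case=> [[x [v H]]|].
  by split; intros; judge_inv; exact: (ev_succ (_ :: _)).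
case=> [[v [i [y [Ha H]]]]|].
  by split; intros; judge_inv; rewrite (Na _ _ _ erefl); constructor.
case=> [[f [gs [v [ws [y [Ha [Hb H]]]]]]]|].
  split; intros; judge_inv => //.
  by case: (La _ _ _ erefl) => ws' E Hws; subst; apply: ev_comp Hws (Eb _ _ _ erefl).
case=> [[f [g [v [y [Ha H]]]]]|].
  by split; intros; judge_inv => //; apply: ev_prim0 (Ea _ _ _ erefl).
case=> [[f [g [n [v [r [y [Ha [Hb H]]]]]]]]|].
  split; intros; judge_inv => //.
  exact: ev_primS (Ea (RPrim _ _) (_ :: _) _ erefl) (Eb _ (_ :: _ :: _) _ erefl).
case=> [[f [v [y [Ha [Hb H]]]]]|].
  split; intros; judge_inv => //.
  exact: ev_mu (Ea _ (_ :: _) _ erefl) (Mb _ _ _ erefl).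
case=> [[f [v H]]|].
  by split; intros; judge_inv.
case=> [[f [v [y [m [Ha [Hb H]]]]]]|].
  split; first [by intros; judge_inv | move=> f' v' y' E z zy]; judge_inv.
  move: zy; rewrite ltnS leq_eqVlt => /predU1P[->|].
    by exists m; exact: (Eb _ (_ :: _) _ erefl).
  exact: (Ma _ _ _ erefl).
case=> [[v H]|].
  by split; intros; judge_inv => //; exists [::] => //; constructor.
case=> [[g [gs [v [w [ws [Ha [Hb H]]]]]]]|].
  split; intros; judge_inv => //.
  case: (Lb _ _ _ erefl) => ws' E Hws; subst; exists (w :: ws') => //.
  exact: evs_cons (Ea _ _ _ erefl) Hws.
case=> [[i H]|].
  by split; intros; judge_inv => //; rewrite nth_nil.
case=> [[x [v H]]|].
  by split; intros; judge_inv.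
case=> [x [v [i [y [Ha H]]]]].
by split; intros; judge_inv => //; rewrite (Na _ _ _ erefl).
Qed.

Tactic Notation "derive_step" int_or_var(n) constr(Ha) constr(Hb) :=
  apply: (derivableS Ha Hb); rewrite /step; do n right; first [left; do !eexists | do !eexists].

Lemma derivable_nth v i : derivable (judge 3 (code_seq v) i (nth 0 v i)).
Proof.
elim: v i => [|x v IHv] [|i] /=.
- derive_step 12 derivable0 derivable0.
- derive_step 12 derivable0 derivable0.
- derive_step 13 derivable0 derivable0.
- derive_step 14 (IHv i) derivable0.
Qed.

Lemma eval_derivable p v y : eval p v y -> derivable (judge 0 (code p) (code_seq v) y).
Proof.
have D0 := derivable0.
apply: (eval_evals_ind (P := fun p v y => derivable (judge 0 (code p) (code_seq v) y))
  (Q := fun gs v ws =>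
     derivable (judge 1 (code_seq (map code gs)) (code_seq v) (code_seq ws)))) => {p v y} /=.
- by move=> v; derive_step 0 D0 D0.
- by case=> [|x v] /=; [derive_step 1 D0 D0|derive_step 2 D0 D0].
- by move=> i v; derive_step 3 (derivable_nth v i) D0.
- by move=> f gs v ws y Hgs Hf; derive_step 4 Hgs Hf.
- by move=> f g v y Hf; derive_step 5 Hf D0.
- by move=> f g n v r y Hr Hg; derive_step 6 Hr Hg.
- move=> f v y H0 HS; suff Hy : derivable (judge 2 (code f) (code_seq v) y).
    by derive_step 7 H0 Hy.
  (* The premises for all [z < y] are gathered one at a time. *)
  elim: y HS {H0} => [|y IHy] HS; first by derive_step 8 D0 D0.
  have [m Hm] := HS y (ltnSn y).
  have {}IHy := IHy (fun z zy => HS z (ltnW zy)).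
  by derive_step 9 IHy Hm.
- by move=> v; derive_step 10 D0 D0.
- by move=> g gs v w ws Hg Hgs; derive_step 11 Hg Hgs.
Qed.

(** * Derivations as coded sequences of numbers *)

Definition justified (f : nat -> nat) (i : nat) : Prop :=
  f i = 0 \/ exists j k, [/\ j < i, k < i & step (f j) (f k) (f i)].

Lemma derivable_sequence c : derivable c <->
  exists N f, f N = c /\ forall i, i < N.+1 -> justified f i.
Proof.
split.
  elim=> [|a b {}c _ [N [f [Ef Jf]]] _ [M [g [Eg Jg]]] Hs].
    by exists 0, (fun=> 0); split=> // i _; left.
  (* Concatenation: [f] fills the places up to [N], [g] the next [M + 1], and the conclusion comes
     last. *)
  pose h i := if i < N.+1 then f i else if i < (N + M).+2 then g (i - N.+1) else c.
  have hf i : i < N.+1 -> h i = f i by rewrite /h => ->.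
  have hg i : i < M.+1 -> h (N.+1 + i) = g i.
    by move=> iM; rewrite /h ifF ?ifT ?addKn //; lia.
  have hc : h (N + M).+2 = c by rewrite /h !ifF //; lia.
  exists (N + M).+2, h; split=> // i iN; case: (ltnP i N.+1) => [iN1|Ni].
    case: (Jf i iN1) => [E|[j [k [ji ki H]]]]; [left|right; exists j, k].
      by rewrite hf.
    by split=> //; rewrite !hf //; lia.
  case: (ltnP i (N + M).+2) => [iM|Mi].
    have -> : i = N.+1 + (i - N.+1) by lia.
    have iM1 : i - N.+1 < M.+1 by lia.
    case: (Jg _ iM1) => [E|[j [k [ji ki H]]]]; [left|right; exists (N.+1 + j), (N.+1 + k)].
      by rewrite hg.
    by split; rewrite ?ltn_add2l // !hg //; lia.
  have -> : i = (N + M).+2 by lia.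
  right; exists N, (N.+1 + M); split; [lia|lia|].
  by rewrite hc hf // hg // Ef Eg.
case=> N [f [<- J]]; move: (ltnSn N); move: {-2}N => i; elim/ltn_ind: i => i IH iN.
case: (J i iN) => [->|[j [k [ji ki H]]]]; first exact: derivable0.
by apply: derivableS H; apply: IH => //; lia.
Qed.

(* Gödel's beta function, with moduli [D / i.+1 - 1]. *)
Definition beta (D c i s : nat) : Prop :=
  exists m, i.+1 * m.+1 = D /\ s = c %% m.

Lemma beta_fun D c i s s' : beta D c i s -> beta D c i s' -> s = s'.
Proof.
case=> m [<- ->] [m' [E ->]]; congr (_ %% _).
by apply/eqP; rewrite -eqSS -(@eqn_pmul2l i.+1) // E.
Qed.

(** The moduli are those of bounded quantification, with [L] above all values, so that the
    remainders are the values themselves. *)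
Lemma beta_sequence f N : exists D c, forall i, i < N -> beta D c i (f i).
Proof.
have [u Hu] := finite_bound (fun k _ => f k) N 1.
pose L := N + u + 3; have L3 : 2 < L by rewrite /L; lia.
have NL : N <= L by rewrite /L; lia.
exists (L`! ^ 2), (crt (modulus L) f N) => i iN; have iL := leq_trans iN NL.
exists (modulus L i); split; first by rewrite modulusE.
rewrite (@crtP _ f _ (coprime_moduli L3 NL)) // modn_small //.
apply: leq_trans (modulus_gt L3 iL); apply: leq_trans (Hu i 0 iN isT) _.
by rewrite /L; lia.
Qed.

(** Two numbers [D] and [b] replace the sequence, and what stands under the bounded quantifier is
    polynomial, as [dio_ball] demands. *)
Lemma derivable_beta c : derivable c <->
  exists N D b, beta D b N c /\ forall i, i < N.+1 ->
    exists s, beta D b i s /\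
      (s = 0 \/ exists j k x y,
         j < i /\ k < i /\ beta D b j x /\ beta D b k y /\ step x y s).
Proof.
rewrite derivable_sequence; split.
  case=> N [f [<- J]]; have [D [b Hb]] := beta_sequence f N.+1.
  exists N, D, b; split=> [|i iN]; first exact: Hb.
  exists (f i); split; first exact: Hb.
  case: (J i iN) => [|[j [k [ji ki H]]]]; first by left.
  right; exists j, k, (f j), (f k); do ![split => //]; apply: Hb; lia.
case=> N [D [b [HN H]]].
(* Since [finite_choice] chooses environments, the entry at place [k] is stored in variable 0. *)
have [W HW] : exists W, forall k, k < N.+1 -> beta D b k (W k 0).
  apply: (finite_choice (P := fun k w => beta D b k (w 0))) => k /H[s [Hs _]].
  by exists (fun=> s).
exists N, (fun k => W k 0); split=> [|i iN].
  exact: beta_fun (HW N (ltnSn N)) HN.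
have [s [Hs Hj]] := H i iN; rewrite /justified (beta_fun (HW i iN) Hs).
case: Hj => [|[j [k [x [y [ji [ki [Hx [Hy Hst]]]]]]]]]; [by left|right; exists j, k].
by rewrite (beta_fun (HW j _) Hx) ?(beta_fun (HW k _) Hy) //; lia.
Qed.

Lemma dio_step_vars b i j k : dio b (fun e => step (e i) (e j) (e k)).
Proof. by rewrite /step /judge /pcons /pr; dio_auto. Qed.

Lemma dio_beta b f g h k : dio_fun b f -> dio_fun b g -> dio_fun b h -> dio_fun b k ->
  dio b (fun e => beta (f e) (g e) (h e) (k e)).
Proof.
move=> Df Dg Dh Dk; rewrite /beta; repeat dio_step; try exact: dio_fun_shift.
by apply: dio_fun_mod; [exact: dio_fun_shift|repeat dio_step].
Qed.

(** The number [pcons n 0] codes [[:: n]]. Derivability makes sense even when [n] codes no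
    function. *)
Definition halts_one (n : nat) : Prop := derivable (judge 0 n (pcons n 0) 1).

Lemma dio_halts_one : dio true (fun e => halts_one (e 0)).
Proof.
apply: dio_iff => [e|]; first exact: derivable_beta.
rewrite /judge /pcons /pr; do 3!apply: dio_ex; apply: dio_and.
  by apply: dio_beta; dio_auto.
apply: dio_ball; last by dio_auto.
repeat first [apply: dio_beta | apply: dio_step_vars | dio_step].
Qed.

(** At the code of [p] itself, [halts_one] gives value 1 by soundness, against the promised 0; its
    negation promises value 1, which by completeness gives [halts_one]. *)
Lemma diagonal p :
  (forall n, (halts_one n -> eval p [:: n] 0) /\ (~ halts_one n -> eval p [:: n] 1)) -> False.
Proof.
move=> /(_ (code p))[H0 H1].
have N : ~ halts_one (code p).
  move=> H; have [/(_ p [:: code p] 1 erefl) E _ _ _] := derivable_true H.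
  by have := eval_fun E (H0 H).
exact: (N (eval_derivable (H1 N))).
Qed.

(** * Elementary constraints *)

(* [Read] imposes nothing: it only makes a variable visible in the matrix of a word. *)
Inductive constr : Type :=
| Read of nat
| Param of nat
| Lin (c0 : nat) (ci i cj j k : nat)
| Quad (i j k : nat)
| Pow (i k : nat).

Definition sat (n : nat) (x : nat -> nat) (c : constr) : bool :=
  match c with
  | Read _ => true
  | Param k => n == x k
  | Lin c0 ci i cj j k => c0 + ci * x i + cj * x j == x k
  | Quad i j k => x i * x j == x k
  | Pow i k => 2 ^ x i == x k
  end.

(** For [Quad] the order [i < j] matters: when block [j] is read, a register must already hold
    [x_i]. *)
Definition below (m : nat) (c : constr) : bool :=
  match c with
  | Read k | Param k => k < m
  | Lin _ _ i _ j k => [&& i < m, j < m & k < m]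
  | Quad i j k => [&& i < j, j < m & k < m]
  | Pow i k => (i < m) && (k < m)
  end.

Lemma below_leq m m' c : m <= m' -> below m c -> below m' c.
Proof. by case: c => /=; lia. Qed.

Lemma eq_sat_below m n x y c :
  below m c -> (forall i, i < m -> x i = y i) -> sat n x c = sat n y c.
Proof.
move=> H E; case: c H => //= [k|c0 ci i cj j k|i j k|i k] H; rewrite !E //; lia.
Qed.

Lemma eq_all_sat m n x y C : all (below m) C -> (forall i, i < m -> x i = y i) ->
  all (sat n x) C = all (sat n y) C.
Proof. by move=> H E; elim: C H => //= c C IHC /andP[Hc /IHC->]; rewrite (eq_sat_below n Hc E). Qed.

Lemma all_below_leq m m' C : m <= m' -> all (below m) C -> all (below m') C.
Proof. by move=> mm; apply: sub_all => c; apply: below_leq. Qed.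

(** The result lists the constraints, the variable holding the value and the next fresh variable. A
    right factor is first copied to a fresh variable, so that [Quad] gets increasing indices. *)
Fixpoint compile (t : tm) (m : nat) : seq constr * nat * nat :=
  match t with
  | TVar i => ([::], i, m)
  | TCst c => ([:: Lin c 0 m 0 m m], m, m.+1)
  | TAdd a b =>
      let: (C1, o1, m1) := compile a m in
      let: (C2, o2, m2) := compile b m1 in
      (Lin 0 1 o1 1 o2 m2 :: C1 ++ C2, m2, m2.+1)
  | TMul a b =>
      let: (C1, o1, m1) := compile a m in
      let: (C2, o2, m2) := compile b m1 in
      (Lin 0 1 o2 0 o2 m2 :: Quad o1 m2 m2.+1 :: C1 ++ C2, m2.+1, m2.+2)
  | TExp a =>
      let: (C1, o1, m1) := compile a m in
      (Pow o1 m1 :: C1, m1, m1.+1)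
  end.

Lemma compileP t m C o m' : tbound t <= m -> compile t m = (C, o, m') ->
  [/\ m <= m', o < m', all (below m') C,
      forall n x, all (sat n x) C -> x o = ev t x &
      forall n x, exists2 y, (forall i, i < m -> y i = x i) & all (sat n y) C].
Proof.
elim: t m C o m' => [i|c|a IHa b IHb|a IHa b IHb|a IHa] m C o m' /= tm.
- by case=> <- <- <-; split=> // n x; exists x.
- case=> <- <- <-; split=> //=; first by rewrite ltnSn.
    by move=> n x; rewrite !addn0 andbT => /eqP.
  move=> n x; exists (fun i => if i == m then c else x i) => [i im|].
    by rewrite ifF //; lia.
  by rewrite !addn0 eqxx andbT.
- case Ea: (compile a m) => [[C1 o1] m1]; case Eb: (compile b m1) => [[C2 o2] m2].
  have ta : tbound a <= m by lia.
  have [mm1 om1 B1 S1 X1] := IHa _ _ _ _ ta Ea.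
  have tb : tbound b <= m1 by lia.
  have [mm2 om2 B2 S2 X2] := IHb _ _ _ _ tb Eb.
  case=> <- <- <-; split; [lia|lia| | |].
  + rewrite /= all_cat (all_below_leq _ B1) ?(all_below_leq _ B2) ?andbT; lia.
  + move=> n x /=; rewrite all_cat !mul1n => /and3P[/eqP<- /S1<- /S2<-]; lia.
  + move=> n x; have [y Ey Sy] := X1 n x; have [z Ez Sz] := X2 n y.
    pose u i := if i == m2 then z o1 + z o2 else z i.
    have Eu i : i < m2 -> u i = z i by rewrite /u => im; rewrite ifF //; lia.
    exists u => [i im|]; first by rewrite Eu ?Ez ?Ey //; lia.
    have Em : u m2 = z o1 + z o2 by rewrite /u eqxx.
    have Eo1 : u o1 = z o1 by apply: Eu; lia.
    rewrite /= all_cat (eq_all_sat n B2 Eu) Sz andbT Em Eo1 Eu // !mul1n eqxx /=.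
    rewrite (eq_all_sat n (y := y) B1) // => i im.
    by rewrite Eu ?Ez //; lia.
- case Ea: (compile a m) => [[C1 o1] m1]; case Eb: (compile b m1) => [[C2 o2] m2].
  have ta : tbound a <= m by lia.
  have [mm1 om1 B1 S1 X1] := IHa _ _ _ _ ta Ea.
  have tb : tbound b <= m1 by lia.
  have [mm2 om2 B2 S2 X2] := IHb _ _ _ _ tb Eb.
  case=> <- <- <-; split; [lia|lia| | |].
  + rewrite /= all_cat (all_below_leq _ B1) ?(all_below_leq _ B2) ?andbT; lia.
  + move=> n x /=; rewrite all_cat mul1n !addn0.
    by move=> /and4P[/eqP E /eqP <- /S1<- /S2<-]; rewrite -E.
  + move=> n x; have [y Ey Sy] := X1 n x; have [z Ez Sz] := X2 n y.
    pose u i := if i == m2 then z o2 else if i == m2.+1 then z o1 * z o2 else z i.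
    have Eu i : i < m2 -> u i = z i by rewrite /u => im; rewrite !ifF //; lia.
    exists u => [i im|]; first by rewrite Eu ?Ez ?Ey //; lia.
    have Em : u m2 = z o2 by rewrite /u eqxx.
    have Eo1 : u o1 = z o1 by apply: Eu; lia.
    have Em1 : u m2.+1 = z o1 * z o2 by rewrite /u eqxx ifF //; lia.
    rewrite /= all_cat (eq_all_sat n B2 Eu) Sz andbT Em Em1 Eo1 Eu // !mul1n !addn0 !eqxx /=.
    rewrite (eq_all_sat n (y := y) B1) // => i im.
    by rewrite Eu ?Ez //; lia.
- case Ea: (compile a m) => [[C1 o1] m1].
  have [mm1 om1 B1 S1 X1] := IHa _ _ _ _ tm Ea.
  case=> <- <- <-; split; [lia|lia| | |].
  + rewrite /= (all_below_leq _ B1); lia.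
  + by move=> n x /= /andP[/eqP<- /S1<-].
  + move=> n x; have [y Ey Sy] := X1 n x.
    pose u i := if i == m1 then 2 ^ y o1 else y i.
    have Eu i : i < m1 -> u i = y i by rewrite /u => im; rewrite ifF //; lia.
    exists u => [i im|]; first by rewrite Eu ?Ey //; lia.
    by rewrite /= (eq_all_sat n B1 Eu) Sy Eu // /u !eqxx.
Qed.

(** Variable [m2] must equal both sides. The even variables are the parameters, all set to [n], and
    the [Read] constraints expose every unknown. *)
Definition equation_system (p q : tm) : seq constr * nat :=
  let: (C1, o1, m1) := compile p (maxn (tbound p) (tbound q)) in
  let: (C2, o2, m2) := compile q m1 in
  let m := m2.+2 in
  (Lin 0 1 o1 0 o1 m2 :: Lin 0 1 o2 0 o2 m2 :: C1 ++ C2 ++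
   [seq Param i.*2 | i <- iota 0 m2 & i.*2 < maxn (tbound p) (tbound q)] ++
   [seq Read i | i <- iota 0 m], m).

Lemma equation_systemP p q : let: (C, m) := equation_system p q in
  [/\ all (below m) C,
      forall s, s < m -> exists2 i, i < size C & nth (Read 0) C i = Read s &
      forall n, (exists w, ev p (mix (fun=> n) w) = ev q (mix (fun=> n) w)) <->
                (exists x, all (sat n x) C)].
Proof.
rewrite /equation_system; set V := maxn _ _.
have pV : tbound p <= V by rewrite leq_max leqnn.
have qV : tbound q <= V by rewrite leq_max leqnn orbT.
case Ep: (compile p V) => [[C1 o1] m1]; case Eq: (compile q m1) => [[C2 o2] m2].
have [mm1 om1 B1 S1 X1] := compileP pV Ep.
have [mm2 om2 B2 S2 X2] := compileP (leq_trans qV mm1) Eq.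
set P := [seq Param _ | i <- _ & _]; set Rd := [seq Read _ | i <- _].
have BP : all (below m2.+2) P.
  by rewrite all_map all_filter; apply/allP => i; rewrite mem_iota /=; lia.
have BR : all (below m2.+2) Rd.
  by rewrite all_map; apply/allP => i; rewrite mem_iota.
have SP n x : all (sat n x) P <-> (forall i, i.*2 < V -> n = x i.*2).
  rewrite all_map all_filter; split=> [/allP H i iV|H].
    by have := H i; rewrite mem_iota /= iV => /(_ ltac:(lia)) /eqP.
  by apply/allP => i _ /=; apply/implyP => /H->.
have SR n x : all (sat n x) Rd by rewrite all_map; apply/allP.
split.
- rewrite /= !all_cat BP BR (all_below_leq _ B1) ?(all_below_leq _ B2) ?andbT; lia.
- move=> s sm; exists ((size C1 + (size C2 + (size P + s))).+2).
    have sR : size Rd = m2.+2 by rewrite size_map size_iota.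
    by rewrite /= !size_cat sR; lia.
  rewrite /= !nth_cat !ifF; try lia.
  rewrite (_ : _ - _ - _ - _ = s); last lia.
  by rewrite (nth_map 0) ?nth_iota ?size_iota.
move=> n; split.
- case=> w Hw; have [y Ey Sy] := X1 n (mix (fun=> n) w); have [z Ez Sz] := X2 n y.
  have Sz1 : all (sat n z) C1 by rewrite (eq_all_sat n (y := y) B1).
  pose u i := if i < m2 then z i else z o1.
  have Eu i : i < m2 -> u i = z i by rewrite /u => ->.
  have B1' := all_below_leq mm2 B1.
  have EV i : i < V -> z i = mix (fun=> n) w i by move=> iV; rewrite Ez ?Ey //; lia.
  have Ezo : z o1 = z o2.
    rewrite (S1 _ _ Sz1) (S2 _ _ Sz) (@eq_ev_bound p _ (mix (fun=> n) w)) ?Hw.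
      by apply: eq_ev_bound => i ti; rewrite EV //; lia.
    by move=> i ti; rewrite EV //; lia.
  exists u; rewrite /= !all_cat (eq_all_sat n B1' Eu) (eq_all_sat n B2 Eu) Sz1 Sz SR andbT /=.
  have -> : u m2 = z o1 by rewrite /u ltnn.
  have -> : u o1 = z o1 by apply: Eu; lia.
  have -> : u o2 = z o2 by apply: Eu.
  rewrite !mul1n !addn0 Ezo eqxx /=; apply/SP => i iV.
  by rewrite Eu ?EV ?/mix ?odd_double //; lia.
- case=> x; rewrite /= !all_cat !mul1n !addn0 !add0n.
  case/and5P=> /eqP E1 /eqP E2 H1 H2 /andP[/SP HP _].
  exists (fun i => x i.*2.+1).
  have Ex i : i < V -> mix (fun=> n) (fun i => x i.*2.+1) i = x i.
    move=> iV; rewrite /mix; case: ifP => oi; last by rewrite (HP i./2) even_halfK ?oi.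
    by rewrite -[in RHS](odd_double_half i) oi.
  rewrite (@eq_ev_bound p _ x) => [|i ti]; last by apply: Ex; lia.
  rewrite (@eq_ev_bound q _ x) => [|i ti]; last by apply: Ex; lia.
  by rewrite -(S1 _ _ H1) -(S2 _ _ H2) E1 E2.
Qed.

(** * From constraints to matrices *)

Section Matrices.
Import GRing.Theory Num.Theory.
Local Open Scope ring_scope.

(* Column [j] has entries [e.2] in the rows [e.1], for [e] in [L j]. *)
Definition sparse k (L : nat -> seq (nat * int)) : 'M[int]_k :=
  \matrix_(i, j) \sum_(e <- L j) (if i == e.1 :> nat then e.2 else 0).

Definition rowv k (f : nat -> int) : 'rV[int]_k := \row_j f j.

Lemma eq_rowv k f g : (forall j, (j < k)%N -> f j = g j) -> rowv k f = rowv k g.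
Proof. by move=> E; apply/rowP => j; rewrite !mxE E. Qed.

(** The triangularity bound also guarantees that every listed row exists, so no summand is lost. *)
Lemma rowv_sparse k f L : (forall j, (j < k)%N -> all (fun e => e.1 <= j)%N (L j)) ->
  rowv k f *m sparse k L = rowv k (fun j => \sum_(e <- L j) f e.1 * e.2).
Proof.
move=> HL; apply/rowP => j; rewrite !mxE.
under eq_bigr do rewrite !mxE mulr_sumr.
rewrite exchange_big /=; apply: eq_big_seq => e /(allP (HL j (ltn_ord j))) /= ej.
rewrite (bigD1 (Ordinal (leq_ltn_trans ej (ltn_ord j)))) //= eqxx big1 ?addr0 // => i.
by rewrite -val_eqE /= => /negPf->; rewrite mulr0.
Qed.

Lemma sparse_upper_tri k L : (forall j, (j < k)%N -> all (fun e => e.1 <= j)%N (L j)) ->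
  upper_tri (sparse k L).
Proof.
move=> HL i j ji; rewrite mxE; apply: big1_seq => e /andP[_].
by move=> /(allP (HL j (ltn_ord j))) ej; rewrite ifF //; lia.
Qed.

(** Register [p] holds [x_i] or [2^(x_i)], and [q] collects the defect, up to the power in the case
    of [Pow]. There [p_init] is 1 and also switches on the addition of [p] in the last block. *)
Definition p_mul (c : constr) (s : nat) : int :=
  if c is Pow i _ then (if s == i then 2 else 1) else 1.

Definition p_add (c : constr) (s : nat) : int :=
  match c with Read i | Quad i _ _ => (s == i)%:Z | _ => 0 end.

Definition q_mul (c : constr) (s : nat) : int :=
  if c is Quad _ j _ then (s == j)%:Z else 0.

Definition q_add (c : constr) (s : nat) : int :=
  match c with
  | Read _ => 0
  | Param k | Quad _ _ k | Pow _ k => - (s == k)%:Z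
  | Lin _ ci i cj j k => ci%:Z * (s == i)%:Z + cj%:Z * (s == j)%:Z - (s == k)%:Z
  end.

Definition p_init (c : constr) : int := if c is Pow _ _ then 1 else 0.

Definition q_init (n : nat) (c : constr) : int :=
  match c with Param _ => n%:Z | Lin c0 _ _ _ _ _ => c0%:Z | _ => 0 end.

(* Effect on the registers [(p, q, r)] of constraint [c] of one letter [x] in the [s]-th
   block of the word.  The last block makes [r] a multiple of the defect of [c]. *)
Definition reg_step (m : nat) (c : constr) (s : nat) (t : int * int * int) : int * int * int :=
  let: (p, q, r) := t in
  (p * p_mul c s + p_add c s, q + p * q_mul c s + q_add c s,
   r + (q + p * p_init c) * (s == m)%:Z).

Variables (m : nat) (sys : seq constr).
Let r := size sys.
Let cst h := nth (Read 0) sys h.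
Definition dim : nat := (m.+1 * r * 4)%N.

(** The vector has one copy of all registers per block, nonzero only for the current block. So [x]
    can act differently in each block, and [y] shifts to the next copy. The leading 1 makes affine
    updates linear. *)
Definition state (s : nat) (t : nat -> int * int * int) (j : nat) : int :=
  if (j %/ 4 %/ r == s)%N then
    let: (p, q, u) := t (j %/ 4 %% r)%N in nth 0 [:: 1; p; q; u] (j %% 4)%N
  else 0.

Definition x_col (j : nat) : seq (nat * int) :=
  let h := (j %/ 4)%N in let s := (h %/ r)%N in let c := cst (h %% r)%N in
  match (j %% 4)%N with
  | 0 => [:: ((h * 4)%N, 1)]
  | 1 => [:: ((h * 4 + 1)%N, p_mul c s); ((h * 4)%N, p_add c s)]
  | 2 => [:: ((h * 4 + 2)%N, 1); ((h * 4 + 1)%N, q_mul c s); ((h * 4)%N, q_add c s)]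
  | _ => [:: ((h * 4 + 3)%N, 1); ((h * 4 + 2)%N, (s == m)%:Z);
             ((h * 4 + 1)%N, (s == m)%:Z * p_init c)]
  end.

Definition y_col (j : nat) : seq (nat * int) :=
  if (j < r * 4)%N then [::] else [:: ((j - r * 4)%N, 1)].

Definition init (n h : nat) : int * int * int := (p_init (cst h), q_init n (cst h), 0).

Definition z1_col (n j : nat) : seq (nat * int) := [:: (0%N, state 0 (init n) j)].

Definition morph (n : nat) (l : letter) : 'M[int]_dim :=
  match l with
  | lx => sparse dim x_col
  | ly => sparse dim y_col
  | lz1 => sparse dim (z1_col n)
  | lz2 => 1%:M
  end.

Lemma x_col_leq j : all (fun e => e.1 <= j)%N (x_col j).
Proof.
have := divn_eq j 4; have : (j %% 4 < 4)%N by rewrite ltn_mod.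
by rewrite /x_col; case: (j %% 4)%N => [|[|[|[|l]]]] //= _ E; lia.
Qed.

Lemma y_col_leq j : all (fun e => e.1 <= j)%N (y_col j).
Proof. by rewrite /y_col; case: ifP => //= _; rewrite leq_subr. Qed.

Lemma morph_upper_tri n l : upper_tri (morph n l).
Proof.
case: l; try by apply: sparse_upper_tri => j _; rewrite ?x_col_leq ?y_col_leq.
by move=> i j ji; rewrite mxE -val_eqE /= gtn_eqF.
Qed.

Lemma stateE s t h l : (l < 4)%N -> state s t (h * 4 + l)%N =
  if (h %/ r == s)%N then let: (p, q, u) := t (h %% r)%N in nth 0 [:: 1; p; q; u] l else 0.
Proof. by move=> l4; rewrite /state divnMDl // modnMDl (divn_small l4) (modn_small l4) addn0. Qed.

Lemma state_x s t : rowv dim (state s t) *m sparse dim x_col =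
  rowv dim (state s (fun h => reg_step m (cst h) s (t h))).
Proof.
rewrite rowv_sparse => [|j _]; last exact: x_col_leq.
apply: eq_rowv => j _; rewrite (divn_eq j 4).
have : (j %% 4 < 4)%N by rewrite ltn_mod.
move: (j %/ 4)%N (j %% 4)%N => h l l4; rewrite stateE // /x_col divnMDl //.
rewrite modnMDl (modn_small l4) (divn_small l4) addn0.
have st0 := stateE s t h (isT : (0 < 4)%N); rewrite addn0 in st0.
case: l l4 => [|[|[|[|l]]]] // _; rewrite !big_cons big_nil /= ?stateE // ?st0;
  case: (h %/ r =P s)%N => [E|_]; rewrite ?E ?mul0r ?addr0 //; case: (t _) => [[p q] u] /=; ring.
Qed.

Lemma state_y s t : (s < m)%N ->
  rowv dim (state s t) *m sparse dim y_col = rowv dim (state s.+1 t).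
Proof.
move=> sm; rewrite rowv_sparse => [|j _]; last exact: y_col_leq.
apply: eq_rowv => j jd; rewrite /y_col; case: (ltnP j (r * 4)) => H.
  by rewrite big_nil /state divn_small ?ltn_divLR.
have r0 : (0 < r)%N by move: jd; rewrite /dim; case: (r) => //; lia.
rewrite big_cons big_nil addr0 mulr1.
rewrite /state -[in RHS](subnKC H) divnMDl // modnMDl modnDl.
by rewrite -[X in ((X + _) %/ r)%N]mul1n divnMDl // add1n eqSS.
Qed.

Fixpoint regs (c : constr) (s : nat) (a : seq nat) (t : int * int * int) : int * int * int :=
  if a is x :: a' then regs c s.+1 a' (iter x (reg_step m c s) t) else t.

Lemma mword_cat k (mu : letter -> 'M[int]_k) w w' :
  mword mu (w ++ w') = mword mu w *m mword mu w'.
Proof. by elim: w => [|l w IHw] /=; rewrite ?mul1mx // IHw mulmxA. Qed.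

Lemma state_nseq n a s t : rowv dim (state s t) *m mword (morph n) (nseq a lx) =
  rowv dim (state s (fun h => iter a (reg_step m (cst h) s) (t h))).
Proof.
elim: a t => [|a IHa] t /=; first by rewrite mulmx1.
rewrite mulmxA state_x IHa; apply: eq_rowv => j _; rewrite /state.
by rewrite -iterSr.
Qed.

Lemma state_blocks n a s t : (s + size a <= m)%N ->
  rowv dim (state s t) *m
    mword (morph n) (flatten [seq ly :: nseq x lx | x <- a]) =
  rowv dim (state (s + size a) (fun h => regs (cst h) s.+1 a (t h))).
Proof.
elim: a s t => [|x a IHa] s t /= sa; first by rewrite mulmx1 addn0.
by rewrite mulmxA state_y ?mword_cat ?mulmxA ?state_nseq ?IHa ?addSnnS //; lia.
Qed.

Definition final (n : nat) (a : seq nat) : nat -> int * int * int :=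
  fun h => regs (cst h) 0 a (init n h).

(** Only the first row of the matrix of [z1] can be nonzero, so the product is governed by one row
    vector, updated letter by letter. *)
Lemma mword_Kword n a : size a = m.+1 ->
  mword (morph n) (Kword a) =
  (\col_(i < dim) (i == 0 :> nat)%:Z) *m rowv dim (state m (final n a)).
Proof.
case: a => // x a [sa]; rewrite /Kword /=.
have -> : sparse dim (z1_col n) =
    (\col_(i < dim) (i == 0 :> nat)%:Z) *m rowv dim (state 0 (init n)).
  apply/matrixP => i j; rewrite !mxE big_ord1 !mxE /z1_col big_cons big_nil addr0 /=.
  by case: eqP; rewrite ?mul1r ?mul0r.
rewrite -mulmxA; congr (_ *m _); rewrite !mword_cat /= !mulmx1 mulmxA state_nseq.
by rewrite state_blocks ?sa ?add0n.
Qed.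

Lemma state_inj s t t' : rowv dim (state s t) = rowv dim (state s t') -> (s <= m)%N ->
  forall h, (h < r)%N -> t h = t' h.
Proof.
move=> E sm h hr.
have Ej l : (l < 4)%N -> state s t ((s * r + h) * 4 + l) = state s t' ((s * r + h) * 4 + l).
  move=> l4; have jd : ((s * r + h) * 4 + l < dim)%N by rewrite /dim; nia.
  by have := congr1 (fun M : 'rV_dim => M 0 (Ordinal jd)) E; rewrite !mxE.
have r0 : (0 < r)%N := leq_ltn_trans (leq0n h) hr.
have := Ej 1%N isT; have := Ej 2%N isT; have := Ej 3%N isT.
rewrite !stateE // divnMDl // divn_small // addn0 eqxx modnMDl modn_small //.
by case: (t h) (t' h) => [[p q] u] [[p' q'] u'] /= -> -> ->.
Qed.

Lemma mword_Kword_eq n a b : size a = m.+1 -> size b = m.+1 ->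
  mword (morph n) (Kword a) = mword (morph n) (Kword b) <->
  (forall h, (h < r)%N -> final n a h = final n b h).
Proof.
move=> sa sb; rewrite !mword_Kword //; split=> [E|E]; last first.
  congr (_ *m _); apply: eq_rowv => j jd; rewrite /state E // ltn_mod.
  by move: jd; rewrite /dim; case: (r) => //; lia.
case: (posnP r) => [-> //|r0]; apply: (@state_inj m) => //.
have d0 : (0 < dim)%N by rewrite /dim; lia.
apply/rowP => j; have := congr1 (fun M : 'M_dim => M (Ordinal d0) j) E.
by rewrite !mxE !big_ord1 !mxE !mul1r.
Qed.

(* Values of the registers [p] and [q] once the blocks [0 .. s-1] have been read. *)
Definition known (x : nat -> nat) (s i : nat) : int := if (i < s)%N then (x i)%:Z else 0.

Definition p_value (c : constr) (x : nat -> nat) (s : nat) : int :=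
  match c with
  | Read i | Quad i _ _ => known x s i
  | Pow i _ => if (i < s)%N then (2 ^ x i)%N%:Z else 1
  | _ => 0
  end.

Definition q_value (n : nat) (c : constr) (x : nat -> nat) (s : nat) : int :=
  match c with
  | Read _ => 0
  | Param k => n%:Z - known x s k
  | Lin c0 ci i cj j k =>
      c0%:Z + ci%:Z * known x s i + cj%:Z * known x s j - known x s k
  | Quad i j k => known x s i * known x s j - known x s k
  | Pow i k => - known x s k
  end.

Definition defect (n : nat) (c : constr) (x : nat -> nat) : int :=
  q_value n c x m + p_value c x m * p_init c.

Lemma knownS x s i : known x s.+1 i = known x s i + (x s)%:Z * (s == i)%:Z.
Proof.
rewrite /known ltnS leq_eqVlt eq_sym; case: eqP => [->|_] /=; last by rewrite mulr0 addr0.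
by rewrite ltnn mulr1 add0r.
Qed.

Lemma sat_defect n c x : below m c -> sat n x c = (defect n c x == 0).
Proof.
case: c => [i|k|c0 ci i cj j k|i j k|i k] /= H;
  rewrite /defect /= /known /p_init; repeat (rewrite ifT; last lia); try lia.
Qed.

(** For [Quad], [p] changes only in block [i] and is used only in block [j]; as these differ, [q]
    grows linearly in [a]. *)
Lemma iter_reg_step c s a p q u : below m c -> s != m ->
  iter a (reg_step m c s) (p, q, u) =
  (if c is Pow i _ then (if s == i then (2 ^ a)%N%:Z * p else p)
   else p + a%:Z * p_add c s, q + a%:Z * (p * q_mul c s + q_add c s), u).
Proof.
move=> Hc sm; elim: a => [|a IHa].
  by rewrite /= !mul0r !addr0; case: c Hc => // i k _; rewrite mul1r if_same.
rewrite iterS {}IHa /reg_step (negPf sm) mulr0 addr0.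
have Ea : a.+1%:Z = 1 + a%:Z by rewrite intS.
case: c Hc => [i|k|c0 ci i cj j k|i j k|i k] /= Hc; rewrite !Ea; congr (_, _, _); try ring.
- case: (eqVneq s i) => [->|_]; last by rewrite /=; ring.
  by rewrite (_ : (i == j) = false) /=; [ring|lia].
- by case: (s == i); rewrite ?mulr1 ?addr0 // expnS PoszM; ring.
Qed.

(** All variables lie below [m], so in the last block [p] and [q] stand still and each letter adds
    the defect once. *)
Lemma iter_reg_last c b p q : below m c -> iter b (reg_step m c m) (p, q, 0) =
  (p, q, b%:Z * (q + p * p_init c)).
Proof.
move=> Hc; elim: b => [|b IHb]; first by rewrite mul0r.
rewrite iterS {}IHb /reg_step eqxx intS.
have -> : p_mul c m = 1 by case: c Hc => //= i k Hc; rewrite ifF //; lia.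
have -> : p_add c m = 0 by case: c Hc => //= [i|i j k] Hc; lia.
have -> : q_mul c m = 0 by case: c Hc => //= i j k Hc; lia.
have -> : q_add c m = 0 by case: c Hc => //= [k|c0 ci i cj j k|i j k|i k] Hc; nia.
by congr (_, _, _); rewrite /=; ring.
Qed.

Lemma regs_values n c x s l : below m c -> (s + l <= m)%N ->
  regs c s (map x (iota s l)) (p_value c x s, q_value n c x s, 0) =
  (p_value c x (s + l), q_value n c x (s + l), 0).
Proof.
move=> Hc; elim: l s => [|l IHl] s sl; first by rewrite addn0.
rewrite /= iter_reg_step //; last by apply/eqP; lia.
rewrite -addSnnS -IHl; last lia.
congr (regs _ _ _ (_, _, _)); clear IHl.
- case: c Hc => [i|k|c0 ci i cj j k|i j k|i k] /= Hc; rewrite ?knownS ?mulr0 //.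
  case: (eqVneq i s) => [->|/negPf is_]; first by rewrite ltnn ltnSn mulr1.
  by rewrite ltnS (leq_eqVlt i s) is_.
- case: c Hc => [i|k|c0 ci i cj j k|i j k|i k] /= Hc; rewrite ?knownS ?mulr0 //; try ring.
  (* In block [i] the value of [x_j] is still unknown because [i < j], so the product stays 0. *)
  case: (eqVneq s i) => [->|_] /=; last by ring.
  rewrite (_ : (i == j) = false); last lia.
  by rewrite /known (_ : (j < i)%N = false); [rewrite /=; ring|lia].
Qed.

Lemma regs_cat c s a b t : regs c s (a ++ b) t = regs c (s + size a) b (regs c s a t).
Proof. by elim: a s t => [|x a IHa] s t /=; rewrite ?addn0 // IHa addSnnS. Qed.

Hypothesis sys_below : all (below m) sys.

Lemma finalE n a h : size a = m.+1 -> (h < r)%N ->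
  final n a h = (p_value (cst h) (nth 0%N a) m, q_value n (cst h) (nth 0%N a) m,
                 (nth 0%N a m)%:Z * defect n (cst h) (nth 0%N a)).
Proof.
move=> sa hr; have Hc : below m (cst h) by apply: (all_nthP (Read 0) sys_below).
have Ea : a = map (nth 0%N a) (iota 0 m) ++ [:: nth 0%N a m].
  rewrite -[LHS](mkseq_nth 0%N) sa /mkseq -addn1 iotaD map_cat /= add0n.
  by [].
rewrite /final [in LHS]Ea regs_cat size_map size_iota add0n.
have -> : init n h = (p_value (cst h) (nth 0%N a) 0, q_value n (cst h) (nth 0%N a) 0, 0).
  by rewrite /init; case: (cst h) => //= *; rewrite /known /= ?mulr0 ?addr0 ?subr0 ?oppr0.
by rewrite regs_values ?add0n // /= iter_reg_last.
Qed.

Hypothesis sys_read : forall i, (i < m)%N -> exists2 h, (h < r)%N & cst h = Read i.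

(** The [Read] registers determine all entries but the last. Some constraint fails, and its third
    register is the last entry times a nonzero defect. *)
Lemma injective_of_unsat n : ~ (exists x, all (sat n x) sys) ->
  injective_on_K m.+1 (morph n).
Proof.
move=> U a b sa sb /(mword_Kword_eq n sa sb) E; congr Kword.
have Eab i : (i < m)%N -> nth 0%N a i = nth 0%N b i.
  move=> im; have [h hr Eh] := sys_read im.
  by have := E h hr; rewrite !finalE // Eh /= /known im => -[].
have : ~~ all (sat n (nth 0%N a)) sys by apply/negP => H; apply: U; exists (nth 0%N a).
rewrite -has_predC => /(has_nthP (Read 0))[h hr].
rewrite /= sat_defect; last exact: (all_nthP (Read 0) sys_below).
move=> D; have := E h hr; rewrite !finalE // => -[Ep Eq].
rewrite /defect -Ep -Eq => /(mulIf D) -[Em].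
apply: (@eq_from_nth _ 0%N) => [|i]; rewrite sa ?sb // ltnS leq_eqVlt.
by case/predU1P=> [->|/Eab].
Qed.

Lemma count_lx a : size a = m.+1 ->
  count (fun l => if l is lx then true else false) (Kword a) = sumn a.
Proof.
have E b : count (fun l => if l is lx then true else false)
    (flatten [seq ly :: nseq y lx | y <- b]) = sumn b.
  by elim: b => // y b IHb; rewrite /= count_cat count_nseq mul1n IHb.
by case: a => // x a _; rewrite /Kword /= !count_cat addn0 count_nseq mul1n E.
Qed.

(** All defects vanish, so the last entry leaves no trace; the values 0 and 1 give words with
    different numbers of [x]. *)
Lemma not_injective_of_sat n x : all (sat n x) sys -> ~ injective_on_K m.+1 (morph n).
Proof.
move=> S H; pose a b := rcons (mkseq x m) b.
have sz b : size (a b) = m.+1 by rewrite size_rcons size_mkseq.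
suff /(congr1 (count (fun l => if l is lx then true else false))) : Kword (a 0%N) = Kword (a 1%N).
  by rewrite !count_lx // /a -!cats1 !sumn_cat /=; lia.
apply: H => //; apply/(mword_Kword_eq n (sz _) (sz _)) => h hr.
have Hc : below m (cst h) by apply: (all_nthP (Read 0) sys_below).
have nx b i : (i < m)%N -> nth 0%N (a b) i = x i.
  by move=> im; rewrite nth_rcons size_mkseq im nth_mkseq.
have D b : defect n (cst h) (nth 0%N (a b)) = 0.
  apply/eqP; rewrite -sat_defect // (eq_sat_below n Hc (nx b)).
  exact: (all_nthP (Read 0) S).
have K b i : known (nth 0%N (a b)) m i = known x m i.
  by rewrite /known; case: ifP => // im; rewrite nx.
rewrite !finalE // !D !mulr0; congr (_, _, _).
  case: (cst h) => //= [i|i j k|i k]; rewrite ?K //.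
  by case: ifP => // im; rewrite !nx.
by case: (cst h) => //= *; rewrite !K.
Qed.

End Matrices.

(** * Computing the encoding of the morphism *)

Definition computable (f : nat -> nat) : Prop :=
  exists g, forall n, eval g [:: n] (f n).

Lemma computable_const c : computable (fun=> c).
Proof.
elim: c => [|c [g Hg]]; first by exists RZero => n; constructor.
exists (RComp RSucc [:: g]) => n.
by apply: (@ev_comp _ _ _ [:: c]); [do !econstructor|exact: (ev_succ [:: c])].
Qed.

Lemma computable_double : computable double.
Proof.
pose succ2 := RComp RSucc [:: RComp RSucc [:: RProj 1]].
exists (RPrim RZero succ2); elim=> [|n IHn]; first by do !constructor.
apply: ev_primS IHn _; apply: (@ev_comp _ _ _ [:: n.*2.+1]); last exact: (ev_succ [:: n.*2.+1]).
apply: evs_cons (evs_nil _); apply: (@ev_comp _ _ _ [:: n.*2]); last exact: (ev_succ [:: n.*2]).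
by apply: evs_cons (evs_nil _); exact: (ev_proj 1 [:: n; n.*2]).
Qed.

(** The programs do not depend on [n], so composing a decision procedure with them gives one
    recursive function of [n]. *)
Definition uniform_seq (F : nat -> seq nat) : Prop :=
  exists gs, forall n, evals gs [:: n] (F n).

Lemma uniform_map (T : Type) (s : seq T) (f : nat -> T -> nat) :
  (forall x, computable (f^~ x)) -> uniform_seq (fun n => map (f n) s).
Proof.
move=> Hf; elim: s => [|x s [gs Hgs]]; first by exists [::] => n; constructor.
by have [g Hg] := Hf x; exists (g :: gs) => n; constructor.
Qed.

Lemma evals_cat gs hs v ws xs :
  evals gs v ws -> evals hs v xs -> evals (gs ++ hs) v (ws ++ xs).
Proof.
move=> + Hh; elim: gs ws => [|g gs IHgs] ws H; inversion H; subst => //=.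
by constructor=> //; apply: IHgs.
Qed.

Lemma uniform_flatten (T : Type) (s : seq T) (F : nat -> T -> seq nat) :
  (forall x, uniform_seq (F^~ x)) -> uniform_seq (fun n => flatten (map (F n) s)).
Proof.
move=> HF; elim: s => [|x s [hs Hhs]]; first by exists [::] => n; constructor.
by have [gs Hgs] := HF x; exists (gs ++ hs) => n; apply: evals_cat.
Qed.

(** The parameter occurs only in the first row of [z1], as entries [n], which [enc_int] doubles. *)
Lemma computable_enc_morph m sys l i j :
  computable (fun n => enc_int (@morph m sys n l i j)).
Proof.
case: l; try exact: computable_const.
have [g Hg] : computable (fun n => enc_int (state sys 0 (init sys n) j)).
  rewrite /state; case: eqP => _; last exact: computable_const.
  rewrite /init; case: (j %% 4) => [|[|[|[|l]]]] /=; try exact: computable_const.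
  case: (nth _ _ _) => /= *; try exact: computable_const.
  exact: computable_double.
have [i0|/negPf i0] := eqVneq (i : nat) 0; last first.
  have [g' Hg'] := computable_const 0.
  by exists g' => n; rewrite mxE /z1_col big_cons big_nil /= i0.
by exists g => n; rewrite mxE /z1_col big_cons big_nil /= i0 GRing.addr0.
Qed.

Lemma uniform_enc_morph m sys : uniform_seq (fun n => enc_morph (@morph m sys n)).
Proof.
apply: uniform_flatten => l; apply: uniform_flatten => i; apply: uniform_map => j.
exact: computable_enc_morph.
Qed.

Theorem theorem2p2 :
  exists k t : nat, (0 < k)%N /\ (0 < t)%N /\
    ~ (exists p : rf,
         forall mu : letter -> 'M[int]_k,
           (forall l, upper_tri (mu l)) ->
           (injective_on_K t mu -> eval p (enc_morph mu) 1) /\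
           (~ injective_on_K t mu -> eval p (enc_morph mu) 0)).
Proof.
have [p [q [_ _ Hpq]]] := dio_halts_one.
have := equation_systemP p q; case E: (equation_system p q) => [sys m] [Hb Hr Hs].
have r0 : 0 < size sys.
  by move: E; rewrite /equation_system; do 2!case: (compile _ _) => [[? ?] ?]; case=> <-.
(* Both numbers depend on the system alone and not on the parameter [n]. *)
exists (dim m sys), m.+1; split; first by rewrite /dim; lia.
split=> // -[f Hf]; have [gs Hgs] := uniform_enc_morph m sys.
have Hn n : halts_one n <-> exists x, all (sat n x) sys by rewrite -Hs (Hpq (fun=> n)).
(* The composite would answer 0 when the system for [n] is solvable and 1 otherwise. *)
apply: (@diagonal (RComp f gs)) => n.
have [H1 H0] := Hf (@morph m sys n) (@morph_upper_tri m sys n).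
split=> H; apply: ev_comp (Hgs n) _.
  apply: H0; case: (Hn n) => /(_ H)[x Hx] _.
  exact: (not_injective_of_sat Hb Hx).
by apply: H1; apply: injective_of_unsat => // /Hn.
Qed.
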